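(* Let $X$ be a real normed linear space, $Y$ a real Banach space, $1 \leq p < \infty$, and $f\in Lip_0(X,Y)$. Then $f \in \mathcal{K}_{p}^{Ld}(X,Y)$ if and only if there exist a Banach space $Z$, $R \in Lip_{0\mathcal{K}}(X,Z)$ and $U \in \Pi_{p}(Z,Y)$ such that $f = U\circ R$.
   Context: $Lip_0(X,Y)$ is the space of Lipschitz maps $f:X\to Y$ with $f(0)=0$; $X^{\#}=Lip_0(X,\mathbb{R})$ with the best-Lipschitz-constant norm. $Lip_{0\mathcal{K}}(X,Z)$ (Lipschitz compact operators) is the set of $f\in Lip_0(X,Z)$ such that $\left\{\frac{f(x_1)-f(x_2)}{\|x_1-x_2\|}: x_1\ne x_2\in X\right\}$ is relatively compact in $Z$. A subset $K$ of a Banach space $E$ is relatively $p$-compact if there is a sequence $(e_n)$ in $E$ with $\sum_n\|e_n\|^p<\infty$ such that $K\subset\{\sum_n a_n e_n : (a_n)\in B_{\ell_{p'}}\}$, where $p'$ is the conjugate exponent of $p$. A bounded linear operator is $p$-compact if it maps bounded sets to relatively $p$-compact sets; $\mathcal{K}_p(E,G)$ denotes the $p$-compact operators from $E$ to $G$. For $f\in Lip_0(X,Y)$, the Lipschitz transpose is the linear map $f^t:Y^*\to X^{\#}$, $f^t(y^* )=y^*\circ f$, and $\mathcal{K}_p^{Ld}(X,Y)=\{f\in Lip_0(X,Y): f^t\in\mathcal{K}_p(Y^*,X^{\#})\}$. $\Pi_p(Z,Y)$ is the space of (linear, absolutely) $p$-summing operators. *)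

(* Defs.v *)
From HB Require Import structures.
From mathcomp Require Import all_boot all_order all_algebra.
From mathcomp Require Import all_classical all_reals all_analysis.

Set Implicit Arguments.
Unset Strict Implicit.
Unset Printing Implicit Defensive.

Import Order.TTheory GRing.Theory Num.Theory.
Import numFieldNormedType.Exports.

Local Open Scope classical_set_scope.
Local Open Scope ring_scope.

Section sup_image.
Context {R : realType} {T : Type}.
Implicit Types (A : set T) (g h k : T -> R).

Lemma sup_image_ub A g M t :
  (forall t, A t -> g t <= M) -> A t -> g t <= sup (g @` A).
Proof.
move=> gM At; apply: ub_le_sup; last by exists t.
by exists M => _ [u Au <-]; exact: gM.
Qed.

Lemma sup_image_le A g M :
  0 <= M -> (forall t, A t -> g t <= M) -> sup (g @` A) <= M.
Proof.
move=> M0 gM; have [->|/set0P A0] := eqVneq A set0.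
  by rewrite image_set0 sup0.
apply: ge_sup; first exact: image_nonempty.
by move=> _ [t At <-]; exact: gM.
Qed.

Lemma sup_image_ge0 A g : (forall t, A t -> 0 <= g t) -> 0 <= sup (g @` A).
Proof.
move=> g0; have [hs|hs] := pselect (has_sup (g @` A)); last by rewrite sup_out.
case: hs => -[x [t At _]] gub.
by apply: (le_trans (g0 _ At)); apply: ub_le_sup => //; exists t.
Qed.

Lemma sup_imageZ A g h M (l : R) : 0 <= l ->
  (forall t, A t -> 0 <= g t <= M) -> (forall t, A t -> h t = l * g t) ->
  sup (h @` A) = l * sup (g @` A).
Proof.
move=> l0 gM hE.
have g0 t : A t -> 0 <= g t by move=> /gM/andP[].
have gleM t : A t -> g t <= M by move=> /gM/andP[].
have hle t : A t -> h t <= l * sup (g @` A).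
  by move=> At; rewrite hE// ler_wpM2l//; exact: (sup_image_ub gleM).
apply/eqP; rewrite eq_le; apply/andP; split.
  by apply: sup_image_le => //; rewrite mulr_ge0// sup_image_ge0.
have [lz|lz] := eqVneq l 0.
  rewrite [X in X * _]lz mul0r; apply: sup_image_ge0 => t At.
  by rewrite hE// mulr_ge0// g0.
have lpos : 0 < l by rewrite lt0r lz.
rewrite -ler_pdivlMl//; apply: sup_image_le.
  rewrite mulr_ge0 ?invr_ge0//; apply: sup_image_ge0 => t At.
  by rewrite hE// mulr_ge0// g0.
by move=> t At; rewrite ler_pdivlMl// -hE//; exact: (sup_image_ub hle).
Qed.

Lemma sup_imageD A g h k M N :
  (forall t, A t -> 0 <= g t <= M) -> (forall t, A t -> 0 <= h t <= N) ->
  (forall t, A t -> k t <= g t + h t) ->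
  sup (k @` A) <= sup (g @` A) + sup (h @` A).
Proof.
move=> gM hN kgh; apply: sup_image_le.
  by rewrite addr_ge0// sup_image_ge0// => t At;
    [have /andP[] := gM _ At|have /andP[] := hN _ At].
move=> t At; apply: (le_trans (kgh _ At)); rewrite lerD//.
  by apply: (@sup_image_ub _ _ M) => // u /gM/andP[].
by apply: (@sup_image_ub _ _ N) => // u /hN/andP[].
Qed.

End sup_image.

Section lip0.
Context {R : realType} (X Y : normedModType R).
Implicit Types f g : X -> Y.

Definition lip0_pred : {pred X -> Y} := fun f => `[< lipschitz f /\ f 0 = 0 >].

Lemma lipschitzP f :
  lipschitz f <-> exists M, forall x y, `|f x - f y| <= M * `|x - y|.
Proof.
split=> [/pinfty_ex_gt0[M _ fM]|[M fM]].
  by exists M => x y; apply: (fM (x, y)).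
apply: (@klipschitzW _ _ _ M); last by move=> [x y] _; exact: fM.
exact: (@globally_properfilter _ _ (0, 0)).
Qed.

Lemma lip0_submod : submod_closed lip0_pred.
Proof.
split.
  apply/asboolP; split=> //; apply/lipschitzP; exists 0 => x y.
  by rewrite subrr normr0 mul0r.
move=> a f g /asboolP[/lipschitzP[M fM] f0] /asboolP[/lipschitzP[N gN] g0].
apply/asboolP; split; last first.
  by rewrite -[LHS]/(a *: f 0 + g 0) f0 g0 scaler0 addr0.
apply/lipschitzP; exists (`|a| * M + N) => x y.
rewrite -[X in `|X|]/((a *: f x + g x) - (a *: f y + g y)).
rewrite opprD addrACA -scalerBr (le_trans (ler_normD _ _))// mulrDl lerD//.
by rewrite normrZ -mulrA ler_wpM2l.
Qed.

HB.instance Definition _ :=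
  GRing.isSubmodClosed.Build R (X -> Y) lip0_pred lip0_submod.

Record lip0 := MkLip0 { lip0_fun :> X -> Y ; _ : lip0_fun \in lip0_pred }.

HB.instance Definition _ := [isSub for lip0_fun].
HB.instance Definition _ := [Choice of lip0 by <:].
HB.instance Definition _ := [SubChoice_isSubLmodule of lip0 by <:].

Lemma lip0P (f : lip0) : lipschitz f /\ f 0 = 0.
Proof. by case: f => f /= /asboolP. Qed.

Definition slope_norm (f : X -> Y) (x : X * X) : R :=
  `|f x.1 - f x.2| / `|x.1 - x.2|.

(* When X is trivial this set is empty and its [sup] is 0. *)
Definition lip_const (f : lip0) : R :=
  sup [set slope_norm f x | x in [set x | x.1 != x.2]].

Lemma slope_norm_bounded (f : lip0) :
  exists M, forall x, x.1 != x.2 -> 0 <= slope_norm f x <= M.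
Proof.
have [/lipschitzP[M fM] _] := lip0P f; exists M => -[x y] /= xy.
by rewrite /slope_norm divr_ge0//= ler_pdivrMr// normr_gt0 subr_eq0.
Qed.

Lemma lip_constD (f g : lip0) : lip_const (f + g) <= lip_const f + lip_const g.
Proof.
have [M fM] := slope_norm_bounded f; have [N gN] := slope_norm_bounded g.
apply: (sup_imageD fM gN) => -[x y] /= _; rewrite /slope_norm /= -mulrDl.
rewrite ler_wpM2r ?invr_ge0//.
rewrite -[X in `|X|]/((f x + g x) - (f y + g y)) opprD addrACA.
exact: ler_normD.
Qed.

Lemma lip_constZ (l : R) (f : lip0) : lip_const (l *: f) = `|l| * lip_const f.
Proof.
have [M fM] := slope_norm_bounded f.
apply: (sup_imageZ _ fM) => // -[x y] /= _; rewrite /slope_norm /=.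
by rewrite -[X in `|X|]/(l *: f x - l *: f y) -scalerBr normrZ mulrA.
Qed.

Lemma lip_const0_eq0 (f : lip0) : lip_const f = 0 -> f = 0.
Proof.
move=> f0; apply/val_inj/funext => x /=; rewrite -[RHS]/(0 : Y).
have [_ f00] := lip0P f; have [->//|x0] := eqVneq x 0.
have [M fM] := slope_norm_bounded f.
have := @sup_image_ub _ _ [set x | x.1 != x.2] (slope_norm f) M (x, 0).
rewrite -/(lip_const f) f0 => /(_ _ x0).
rewrite /slope_norm /= f00 !subr0 pmulr_lle0 ?invr_gt0 ?normr_gt0//.
by rewrite normr_le0 => H; apply/eqP/H => t /fM/andP[].
Qed.

HB.instance Definition _ := Lmodule_isNormed.Build R lip0
  lip_constD lip_constZ lip_const0_eq0.

End lip0.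
Arguments lip0_pred {R} X Y _.

Section bounded_operators.
Context {R : realType} (E F : normedModType R).
Implicit Types T : E -> F.

Definition bop_pred : {pred E -> F} := fun T => `[< linear T /\ continuous T >].

Lemma bop_submod : submod_closed bop_pred.
Proof.
split.
  apply/asboolP; split; last exact: cst_continuous.
  by move=> a x y; rewrite -[LHS]/(0 : F) -[RHS]/(a *: 0 + 0 : F) scaler0 addr0.
move=> a T S /asboolP[Tl Tc] /asboolP[Sl Sc]; apply/asboolP; split.
  move=> b x y.
  rewrite -[LHS]/(a *: T (b *: x + y) + S (b *: x + y)).
  rewrite -[RHS]/(b *: (a *: T x + S x) + (a *: T y + S y)) Tl Sl.
  by rewrite !scalerDr !scalerA (mulrC a b) addrACA.
move=> x; apply: (@continuousD _ _ _ (a \*: T) S); last exact: Sc.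
by apply: continuousZr; exact: Tc.
Qed.

HB.instance Definition _ :=
  GRing.isSubmodClosed.Build R (E -> F) bop_pred bop_submod.

Record bop := MkBop { bop_fun :> E -> F ; _ : bop_fun \in bop_pred }.

HB.instance Definition _ := [isSub for bop_fun].
HB.instance Definition _ := [Choice of bop by <:].
HB.instance Definition _ := [SubChoice_isSubLmodule of bop by <:].

Lemma bopP (T : bop) : linear T /\ continuous T.
Proof. by case: T => T /= /asboolP. Qed.

HB.instance Definition _ (T : bop) :=
  GRing.isLinear.Build R E F _ (bop_fun T) (bopP T).1.

Definition opnorm (T : bop) : R := sup [set `|T x| | x in [set x | `|x| <= 1]].

Lemma bop_bounded (T : bop) : exists M, forall x, `|T x| <= M * `|x|.
Proof.
have /linear_bounded_continuous/linear_boundedP := (bopP T).2.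
by move=> /pinfty_ex_gt0[M _ TM]; exists M.
Qed.

Lemma bop_bounded_ball (T : bop) :
  exists M, forall x, `|x| <= 1 -> 0 <= `|T x| <= M.
Proof.
have [M TM] := bop_bounded T; exists (Num.max M 0) => x x1.
rewrite normr_ge0/= (le_trans (TM x))//.
apply: (@le_trans _ _ (Num.max M 0 * `|x|)).
  by rewrite ler_wpM2r// le_max lexx.
by rewrite ler_piMr// le_max lexx orbT.
Qed.

Lemma opnormD (T S : bop) : opnorm (T + S) <= opnorm T + opnorm S.
Proof.
have [M TM] := bop_bounded_ball T; have [N SN] := bop_bounded_ball S.
by apply: (sup_imageD TM SN) => x _; exact: (ler_normD (T x) (S x)).
Qed.

Lemma opnormZ (l : R) (T : bop) : opnorm (l *: T) = `|l| * opnorm T.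
Proof.
have [M TM] := bop_bounded_ball T.
by apply: (sup_imageZ _ TM) => // x _; exact: (normrZ l (T x)).
Qed.

Lemma opnorm0_eq0 (T : bop) : opnorm T = 0 -> T = 0.
Proof.
move=> T0; apply/val_inj/funext => x /=; rewrite -[RHS]/(0 : F).
have [->|x0] := eqVneq x 0; first exact: linear0.
have [M TM] := bop_bounded_ball T.
have := @sup_image_ub _ _ [set x | `|x| <= 1] (fun x => `|T x|) M (`|x|^-1 *: x).
rewrite -/(opnorm T) T0 => H.
have : `|T (`|x|^-1 *: x)| <= 0.
  apply: H => [t /TM/andP[]//|/=].
  by rewrite normrZ normfV normr_id mulVf// normr_eq0.
rewrite linearZ/= normrZ normfV normr_id pmulr_rle0 ?invr_gt0 ?normr_gt0//.
by rewrite normr_le0 => /eqP.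
Qed.

HB.instance Definition _ := Lmodule_isNormed.Build R bop
  opnormD opnormZ opnorm0_eq0.

End bounded_operators.
Arguments bop_pred {R} E F _.

Definition lip_dual {R : realType} (X : normedModType R) := lip0 X R^o.

Definition dual_space {R : realType} (E : normedModType R) := bop E R^o.

Section lip_transpose.
Context {R : realType} {X Y : normedModType R} (f : lip0 X Y).

Lemma lip_transpose_subproof (phi : dual_space Y) : phi \o f \in lip0_pred X R^o.
Proof.
have [/lipschitzP[M fM] f0] := lip0P f; have [N phiN] := bop_bounded phi.
apply/asboolP; split; last by rewrite /= f0 linear0.
apply/lipschitzP; exists (Num.max N 0 * M) => x y /=.
rewrite -linearB (le_trans (phiN _))// -mulrA.
apply: (@le_trans _ _ (Num.max N 0 * `|f x - f y|)).
  by rewrite ler_wpM2r// le_max lexx.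
by rewrite ler_wpM2l// le_max lexx orbT.
Qed.

Definition lip_transpose_fun (phi : dual_space Y) : lip_dual X :=
  MkLip0 (lip_transpose_subproof phi).

Lemma lip_transpose_bop : lip_transpose_fun \in bop_pred (dual_space Y) (lip_dual X).
Proof.
have tl : linear lip_transpose_fun.
  by move=> a phi psi; apply/val_inj/funext => x.
pose tL : {linear dual_space Y -> lip_dual X} :=
  HB.pack lip_transpose_fun (GRing.isLinear.Build _ _ _ _ _ tl).
apply/asboolP; split => //; apply: (@bounded_linear_continuous _ _ _ tL).
apply/linear_boundedP.
have [/lipschitzP[M fM] _] := lip0P f.
near=> N => phi.
have N0 : 0 <= N by near: N; exact: nbhs_pinfty_ge.
apply: sup_image_le; first by rewrite mulr_ge0.
move=> -[x y] /= xy; rewrite /slope_norm /=.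
rewrite ler_pdivrMr ?normr_gt0 ?subr_eq0// -linearB.
have [->|fxy] := eqVneq (f x - f y) 0.
  by rewrite linear0 normr0 !mulr_ge0.
have [K phiK] := bop_bounded_ball phi.
have : `|phi (`|f x - f y|^-1 *: (f x - f y))| <= `|phi|.
  apply: (@sup_image_ub _ _ [set x | `|x| <= 1] (fun x => `|phi x|) K).
    by move=> t /phiK/andP[].
  by rewrite /= normrZ normfV normr_id mulVf// normr_eq0.
rewrite linearZ/= normrZ normfV normr_id ler_pdivrMl ?normr_gt0// => /le_trans.
apply; rewrite mulrC (mulrC N) -mulrA ler_wpM2l//.
rewrite (le_trans (fM x y))// ler_wpM2r//.
Unshelve. all: by end_near. Qed.

Definition lip_transpose : bop (dual_space Y) (lip_dual X) := MkBop lip_transpose_bop.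

End lip_transpose.

Definition lip_compact {R : realType} {X Z : normedModType R} (f : lip0 X Z) :=
  precompact [set `|x.1 - x.2|^-1 *: (f x.1 - f x.2) | x in
              [set x : X * X | x.1 != x.2]].

(* Closed unit ball of l_q, as the L_q norm for the counting measure on nat. For
   p = 1 the conjugate exponent is +oo and this is the unit ball of l_oo. *)
Definition lp_ball {R : realType} (q : \bar R) : set (nat -> R) :=
  [set a | 'N[counting]_q [EFin \o a] <= 1]%E.

(* The sum of a_n e_n is the norm limit of the partial sums; over a Banach space
   it always exists for such a and e by Hoelder's inequality. *)
Definition relatively_p_compact {R : realType} {E : normedModType R} (p : R)
    (K : set E) :=
  exists e : nat -> E, (\sum_(0 <= n <oo) (`|e n| `^ p)%:E < +oo)%E /\
    K `<=` [set x | exists2 a, lp_ball (hoelder_conjugate p%:E) a &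
                    [series a n *: e n]_n @ \oo --> x].

Definition p_compact {R : realType} {E F : normedModType R} (p : R)
    (T : bop E F) :=
  forall A : set E, bounded_set A -> relatively_p_compact p (T @` A).

Definition lip_dual_p_compact {R : realType} {X Y : normedModType R} (p : R)
    (f : lip0 X Y) := p_compact p (lip_transpose f).

Definition p_summing {R : realType} {E F : normedModType R} (p : R)
    (T : bop E F) :=
  exists2 C : R, 0 <= C & forall (n : nat) (z : 'I_n -> E),
    (\sum_(i < n) `|T (z i)| `^ p) `^ p^-1 <=
    C * sup [set (\sum_(i < n) `|phi (z i)| `^ p) `^ p^-1 |
             phi in [set phi : dual_space E | `|phi| <= 1]].

(* Main.v *)
Require Import Defs.
From HB Require Import structures.
From mathcomp Require Import all_boot all_order all_algebra.
From mathcomp Require Import all_classical all_reals all_analysis.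
From mathcomp Require finmap.
From mathcomp Require Import ess_sup_inf lra.
Import Order.TTheory GRing.Theory Num.Theory.
Import numFieldNormedType.Exports.
Local Open Scope classical_set_scope.
Local Open Scope ring_scope.
Set Implicit Arguments.
Unset Strict Implicit.
Unset Printing Implicit Defensive.

(** The transpose [f^t] is p-compact exactly when [f] satisfies a quasi p-nuclear
    estimate, that is, when there are [g n] in [X^#] with
    [\sum_n |g n|^p < oo] such that
      [| \sum_i l i f (x i) |^p <= \sum_n | \sum_i l i g n (x i) |^p]
    for all finite families of scalars [l i] and points [x i]; and such an
    estimate is what a Lipschitz compact map followed by a p-summing operator
    provides.

    Let [f = U o S] with [S] Lipschitz compact and [U] p-summing. Pietsch's
    domination, proved here with a finitely additive mean [L] on all bounded
    functions on the dual unit ball of [Z] ([pietsch_domination]), bounds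
    [|U z|^p] by the mean of [C^p |phi z|^p]. Compactness of [S] makes
    [phi |-> phi o S] map the ball to a totally bounded set, so that [phi o S] is
    the sum of a telescoping series whose terms take finitely many values at each
    level and are geometrically small ([transpose_telescope]). The mean
    then becomes a countable sum, and [U] satisfies
    [|U z|^p <= \sum_n |G n z|^p] on the span of [S X], with [G n] in [Z^*] and
    [\sum_n |G n o S|^p < oo] ([quasi_nuclear]). By Hahn-Banach every [phi] in
    the dual ball of [Y] satisfies [phi o U = \sum_n a n * G n] there, with [a]
    in the unit ball of l_p', and summability of the norms makes
    [f^t phi = \sum_n a n * (G n o S)] converge in Lipschitz norm
    ([transpose_expansion]).

    Conversely, let the transpose map the dual unit ball of [Y] into the set of
    sums [\sum_n a n * e n]. Write [|e n| = d n * beta n] with [d] p-summable and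
    [beta] tending to 0 ([null_factorization]). Then
    [S x := (e n x / d n)_n] has its slopes in the compact box
    [|z n| <= beta n] of bounded sequences, and [f x] is a function of [S x]
    through the diagonal operator [z |-> (d n * z n)_n], which is p-summing.
    Rather than extending this function by density, [Z] is taken to be the space
    of all pairs [(z, y)] for which [phi y = \sum_n a n * d n * z n] holds for
    every such expansion: it is linear and complete, it contains [(S x, f x)],
    and [U] is its projection to [Y]. *)

(** * Power sums and the unit ball of l_p' *)

Section real_sums.
Context {R : realType}.

Lemma ler_sum_subseq (u : nat -> R) (s s' : seq nat) : (forall n, 0 <= u n) ->
  uniq s -> uniq s' -> {subset s <= s'} -> \sum_(n <- s) u n <= \sum_(n <- s') u n.
Proof.
move=> u0 us us' ss'; rewrite [leRHS](bigID (mem s))/= -[leLHS]addr0.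
apply: lerD; last exact: sumr_ge0.
have sE : perm_eq s [seq i <- s' | i \in s].
  apply: uniq_perm => //; first exact: filter_uniq.
  by move=> i; rewrite mem_filter; case: (boolP (i \in s)) => //= /ss' ->.
by rewrite (perm_big _ sE)/= big_filter.
Qed.

Lemma ler_sum_support (u v : nat -> R) N M : (forall n, 0 <= v n) ->
  (forall n, (n < N)%N -> u n <= v n) -> (forall n, (N <= n)%N -> u n = 0) ->
  \sum_(0 <= n < M) u n <= \sum_(0 <= n < N) v n.
Proof.
move=> v0 uv uN; have [MN|/ltnW NM] := leqP M N.
  rewrite [leRHS](big_cat_nat (n := M))//= -[leLHS]addr0 lerD ?sumr_ge0//.
  by apply: ler_sum_nat => n /andP[_ nM]; apply: uv; exact: leq_trans MN.
rewrite (big_cat_nat (n := N))//= [X in _ + X]big_nat_cond [X in _ + X]big1 ?addr0.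
  by apply: ler_sum_nat => n /andP[_ nN]; exact: uv.
by move=> n /andP[/andP[/uN]].
Qed.

Lemma tail_sum_le (u : nat -> R) B e : (forall n, 0 <= u n) ->
  (forall N, \sum_(0 <= n < N) u n <= B) -> 0 < e ->
  exists N0, forall N M, (N0 <= N)%N -> \sum_(N <= n < M) u n <= e.
Proof.
move=> u0 uB e0; pose P := range (fun N => \sum_(0 <= n < N) u n).
have supP : has_sup P.
  by split; [exists (\sum_(0 <= n < 0) u n), 0%N|exists B => _ [N _ <-]].
have [_ [N0 _ <-] N0P] := sup_adherent e0 supP.
exists N0 => N M N0N; have [MN|/ltnW NM] := leqP M N; first by rewrite big_geq// ltW.
have : \sum_(0 <= n < M) u n <= sup P by apply: sup_upper_bound => //; exists M.
rewrite (big_cat_nat (n := N0))//= ?(leq_trans N0N)//.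
rewrite (big_cat_nat (n := N) (m := N0))//=.
have : 0 <= \sum_(N0 <= n < N) u n by exact: sumr_ge0.
lra.
Qed.

End real_sums.

Section power_sums.
Context {R : realType}.
Implicit Types (p t u v : R).

Lemma ge1_gt0 p : 1 <= p -> 0 < p. Proof. exact: lt_le_trans. Qed.

Lemma powR_norm_convex p t u v : 1 <= p -> 0 <= t <= 1 ->
  `|t * u + (1 - t) * v| `^ p <= t * `|u| `^ p + (1 - t) * `|v| `^ p.
Proof.
move=> p1 /andP[t0 t1]; have p0 := ge1_gt0 p1.
have ot0 : 0 <= 1 - t by rewrite subr_ge0.
apply: (@le_trans _ _ ((t * `|u| + (1 - t) * `|v|) `^ p)).
  apply: ge0_ler_powR; rewrite ?nnegrE ?(ltW p0) ?addr_ge0 ?mulr_ge0//.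
  by rewrite (le_trans (ler_normD _ _))// !normrM (ger0_norm t0) (ger0_norm ot0).
have := @convex_powR R p p1 (Itv01 t0 t1) `|u| `|v|.
by rewrite !convRE; apply; rewrite inE/= in_itv/= andbT.
Qed.

Lemma powR_normD_le p u v : 1 <= p ->
  `|u + v| `^ p <= 2 `^ (p - 1) * (`|u| `^ p + `|v| `^ p).
Proof.
move=> p1; have p0 := ge1_gt0 p1.
have h : 0 <= (2^-1 : R) <= 1 by apply/andP; split; lra.
have := powR_norm_convex (2 * u) (2 * v) p1 h.
have -> : 2^-1 * (2 * u) + (1 - 2^-1) * (2 * v) = u + v by lra.
rewrite !normrM !powRM// (@ger0_norm _ 2)//.
rewrite (_ : 1 - 2^-1 = 2^-1 :> R); last by lra.
rewrite -mulrDr -mulrDr mulrA (_ : 2^-1 * 2 `^ p = 2 `^ (p - 1))//.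
by rewrite powRB ?pnatr_eq0 ?implybT// powRr1// mulrC.
Qed.

(** Minkowski's inequality in conic form: the pairs [(u, A)] with [A] larger than
    the p-norm of [u] are stable under addition. After division by [A + B] this
    is the convexity of the p-th power, applied to [u / A] and [v / B]. *)
Lemma minkowski_le (I : Type) (s : seq I) (u v : I -> R) p (A B : R) :
  1 <= p -> 0 < A -> 0 < B ->
  \sum_(i <- s) `|u i| `^ p <= A `^ p -> \sum_(i <- s) `|v i| `^ p <= B `^ p ->
  \sum_(i <- s) `|u i + v i| `^ p <= (A + B) `^ p.
Proof.
move=> p1 A0 B0 uA vB; have AB0 : 0 < A + B by rewrite addr_gt0.
have p0 := ge1_gt0 p1.
pose t := A / (A + B).
have tB : 1 - t = B / (A + B) by rewrite /t -[X in X - _](@divff _ (A + B)) ?lt0r_neq0// -mulrBl addrC addKr.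
have t01 : 0 <= t <= 1.
  by rewrite -[t <= 1]subr_ge0 tB !divr_ge0 ?ltW.
have step i : `|u i + v i| `^ p <=
    (A + B) `^ p * (t * (`|u i| `^ p / A `^ p) + (1 - t) * (`|v i| `^ p / B `^ p)).
  have -> : u i + v i = (A + B) * (t * (u i / A) + (1 - t) * (v i / B)).
    have K (C w : R) : 0 < C -> w = (A + B) * (C / (A + B) * (w / C)).
      move=> C0; rewrite mulrA [(A + B) * _]mulrC divfK ?lt0r_neq0//.
      by rewrite mulrC divfK ?lt0r_neq0.
    by rewrite tB mulrDr -!K.
  rewrite normrM powRM// (gtr0_norm AB0) ler_wpM2l ?powR_ge0//.
  apply: le_trans (powR_norm_convex _ _ p1 t01) _.
  have E (w C : R) : 0 < C -> `|w / C| `^ p = `|w| `^ p / C `^ p.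
    move=> C0; rewrite normrM powRM// normfV (gtr0_norm C0) -[C^-1]powR_inv1 ?(ltW C0)//.
    by rewrite powRAC powR_inv1 ?powR_ge0.
  by rewrite !E.
apply: le_trans (ler_sum _ (fun i _ => step i)) _.
rewrite -mulr_sumr ler_piMr ?powR_ge0// big_split/= -!mulr_sumr -!mulr_suml.
apply: (@le_trans _ _ (t * 1 + (1 - t) * 1)); last by lra.
rewrite lerD ?ler_wpM2l ?subr_ge0//; try by case/andP: t01.
  by rewrite ler_pdivrMr ?powR_gt0// mul1r.
by rewrite ler_pdivrMr ?powR_gt0// mul1r.
Qed.

End power_sums.

Section lp_ball.
Context {R : realType}.
Implicit Types (a b : nat -> R) (p q : R).

Lemma powR_sum_ge0 (I : Type) (s : seq I) (u : I -> R) p :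
  0 <= \sum_(i <- s) u i `^ p.
Proof. by apply: sumr_ge0 => i _; exact: powR_ge0. Qed.

Lemma nneseries_leP (u : nat -> R) (M : R) : (forall n, 0 <= u n) ->
  (\sum_(0 <= n <oo) (u n)%:E <= M%:E)%E <->
  forall N, \sum_(0 <= n < N) u n <= M.
Proof.
move=> u0; split=> [uM N|uM].
  rewrite -lee_fin -sumEFin (le_trans _ uM)//.
  by apply: nneseries_lim_ge => n _ _; rewrite lee_fin.
apply: lime_le.
  by apply: is_cvg_nneseries => n _ _; rewrite lee_fin.
by apply: nearW => N; rewrite sumEFin lee_fin.
Qed.

Lemma nneseries_ltyP (u : nat -> R) : (forall n, 0 <= u n) ->
  (\sum_(0 <= n <oo) (u n)%:E < +oo)%E <->
  exists M, forall N, \sum_(0 <= n < N) u n <= M.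
Proof.
move=> u0; split=> [uoo|[M /(nneseries_leP _ u0) uM]]; last first.
  exact: le_lt_trans uM (ltry _).
have s0 : (0 <= \sum_(0 <= n <oo) (u n)%:E)%E.
  by apply: nneseries_ge0 => n _ _; rewrite lee_fin.
exists (fine (\sum_(0 <= n <oo) (u n)%:E)%E).
by apply/(nneseries_leP _ u0); rewrite fineK// ge0_fin_numE.
Qed.

Lemma counting_eq0 (A : set nat) : @counting _ R A = 0%E -> A = set0.
Proof.
rewrite /counting; case: ifPn => // /asboolP finA [] /eqP.
rewrite pnatr_eq0 finmap.cardfs_eq0 => /eqP fA0.
by rewrite -(fset_setK finA) fA0; apply/seteqP; split=> x; rewrite /= ?finmap.in_fset0.
Qed.

Lemma lp_ball_ooP a : lp_ball +oo%E a <-> forall n, `|a n| <= 1.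
Proof.
rewrite /lp_ball /= unlock /= ifT; last first.
  rewrite lt0e measure_ge0 andbT.
  by apply/eqP => /counting_eq0/seteqP[/(_ 0%N I)].
split=> [/ess_supP[A [_ /counting_eq0 -> a1]] n|a1].
  by apply: contrapT => na; apply: (a1 n); rewrite /= lee_fin.
by apply/ess_supP/nearW => n /=; rewrite lee_fin.
Qed.

Lemma lp_ball_finP q a : 0 < q ->
  lp_ball q%:E a <-> forall N, \sum_(0 <= n < N) `|a n| `^ q <= 1.
Proof.
move=> q0; rewrite -(nneseries_leP 1 (fun n => powR_ge0 `|a n| q)).
rewrite /lp_ball /= Lnorm_counting//.
set s := (X in (X `^ _ <= _)%E <-> _); set t := (X in _ <-> (X <= _)%E).
have -> : s = t by [].
have t0 : (0 <= t)%E by apply: nneseries_ge0 => n _ _; rewrite lee_fin powR_ge0.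
have q'0 : 0 <= q^-1 by rewrite invr_ge0 ltW.
split=> [t1|t1].
  have := gt0_ler_poweR (ltW q0) _ _ t1.
  rewrite -poweRrM mulVf ?gt_eqF// poweRe1// poweR1r; apply.
    by rewrite in_itv/= poweR_ge0 leey.
  by rewrite in_itv/= lee01 leey.
rewrite -(poweR1r q^-1); apply: gt0_ler_poweR => //.
  by rewrite in_itv/= t0 leey.
by rewrite in_itv/= lee01 leey.
Qed.

Lemma hoelder_conjugate_fin p : 1 < p -> hoelder_conjugate p%:E = (p / (p - 1))%:E.
Proof.
move=> p1; have p0 : 0 < p by exact: lt_trans p1.
by rewrite /hoelder_conjugate /= eqe gt_eqF// inver subr_eq0 gt_eqF.
Qed.

(** For [p > 1] the converse of Hoelder's inequality is tested on the extremal sequence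
    [b n = sg (a n) * |a n| ^ (p' - 1)], for which the left-hand side is
    [S := \sum |a n| ^ p'] and the right-hand side is [S ^ (1 / p)]. *)
Lemma lp_ballP p a : 1 <= p -> lp_ball (hoelder_conjugate p%:E) a <->
  forall N b, \sum_(0 <= n < N) a n * b n <=
              (\sum_(0 <= n < N) `|b n| `^ p) `^ p^-1.
Proof.
rewrite le_eqVlt => /predU1P[<-|p1].
  rewrite hoelder_conjugate1 invr1; split=> [/lp_ball_ooP a1 N b|ab].
    rewrite powRr1 ?powR_sum_ge0//; apply: ler_sum => n _.
    rewrite powRr1// (le_trans (ler_norm _))// normrM ler_piMl//; exact: a1.
  apply/lp_ball_ooP => n; have := ab n.+1 (fun k => if k == n then Num.sg (a n) else 0).
  rewrite !big_nat_recr//= !big1_seq ?add0r; last 2 first.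
  - by move=> k; rewrite mem_index_iota => /andP[_ /andP[_ kn]]; rewrite lt_eqF// normr0 powR0 ?oner_eq0.
  - by move=> k; rewrite mem_index_iota => /andP[_ /andP[_ kn]]; rewrite lt_eqF// mulr0.
  by rewrite eqxx mulrC -normrEsg !powRr1// => /le_trans; apply; rewrite normr_sg; case: (_ != _).
have p0 : 0 < p by exact: lt_trans p1.
rewrite hoelder_conjugate_fin//; set q := p / (p - 1).
have q0 : 0 < q by rewrite divr_gt0 ?subr_gt0.
have pq : p^-1 + q^-1 = 1.
  by rewrite /q invf_div -[X in X + _]div1r -mulrDl addrC subrK divff ?gt_eqF.
have qp : (q - 1) * p = q.
  rewrite /q -[X in _ / _ - X](@divff _ (p - 1)) ?gt_eqF ?subr_gt0// -mulrBl.
  by rewrite mulrAC opprB subrKC mul1r.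
rewrite (lp_ball_finP _ q0); split=> [aq N b|ab N].
  set A := \sum_(0 <= n < N) `|b n| `^ p.
  have A0 : 0 <= A by exact: powR_sum_ge0.
  have [Az|Az] := eqVneq A 0.
    rewrite big1_seq ?powR_ge0// => n /andP[_ nN].
    move/eqP: Az; rewrite psumr_eq0 => [/allP/(_ _ nN)/=|k _]; last exact: powR_ge0.
    by rewrite powR_eq0 normr_eq0 => /andP[/eqP -> _]; rewrite mulr0.
  have {Az}A0 : 0 < A by rewrite lt0r Az.
  have Ap : 0 < A `^ p^-1 by rewrite powR_gt0.
  have young n : a n * b n <= A `^ p^-1 * (`|a n| `^ q / q + `|b n| `^ p / A / p).
    rewrite -ler_pdivrMl// mulrCA (le_trans (ler_norm _))// normrM.
    have := @conjugate_powR _ `|a n| `|(A `^ p^-1)^-1 * b n| q p (normr_ge0 _)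
      (normr_ge0 _) q0 p0.
    rewrite addrC pq => /(_ erefl)/le_trans; apply; rewrite lerD2l ler_wpM2r ?invr_ge0 ?(ltW p0)//.
    rewrite normrM powRM// normfV (gtr0_norm Ap) -powRN -powRrM mulNr mulVf ?gt_eqF//.
    by rewrite powR_inv1 ?(ltW A0)// mulrC.
  apply: le_trans (ler_sum _ (fun n _ => young n)) _.
  rewrite -mulr_sumr ler_piMr ?(ltW Ap)// big_split/= -!mulr_suml divff ?gt_eqF//.
  rewrite mul1r -pq addrC lerD2l ler_piMl ?invr_ge0 ?(ltW q0)//; exact: aq.
pose b n := Num.sg (a n) * `|a n| `^ (q - 1).
have bE n : `|b n| `^ p = `|a n| `^ q.
  rewrite normrM normr_sg (ger0_norm (powR_ge0 _ _)).
  case: (eqVneq (a n) 0) => [->|_]; first by rewrite mul0r normr0 !powR0 ?gt_eqF.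
  by rewrite mul1r -powRrM qp.
have abE n : a n * b n = `|a n| `^ q.
  by rewrite mulrCA mulrA -normrEsg mulrC mulrC mulr_powRB1.
have := ab N b; rewrite (eq_bigr _ (fun n _ => abE n)) (eq_bigr _ (fun n _ => bE n)).
set S := \sum_(0 <= n < N) _ => SS.
have [//|S1] := leP S 1.
have S0 : 0 < S by exact: lt_trans S1.
have : 1 `^ q^-1 < S `^ q^-1.
  by apply: gt0_ltr_powR; rewrite ?nnegrE ?invr_gt0// ltW.
rewrite powR1 -(ltr_pM2l (powR_gt0 p^-1 S0)) mulr1 -powRD ?pq ?oner_eq0//.
by rewrite powRr1 ?ltW// ltNge SS.
Qed.

End lp_ball.

(** * The Hahn-Banach theorem *)

Section hahn_banach.
Context {R : realType} {V : lmodType R}.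
Implicit Types (A B G P : set (V * R^o)%type).

Definition linear_relation B := forall a u v, B u -> B v -> B (a *: u + v).

Definition dominated P B := forall x r M, B (x, r) -> P (x, M) -> r <= M.

Section cone.
Variable P : set (V * R^o)%type.
Hypothesis PD : forall u v, P u -> P v -> P (u + v).
Hypothesis PZ : forall a u, 0 < a -> P u -> P (a *: u).
Hypothesis Ptotal : forall x, exists M, P (x, M).

Let good B := linear_relation B /\ dominated P B.

(** Extension by one vector [v]: the admissible values [c] at [v] are those with
    [r' - M' <= c <= M - r] whenever [M] bounds [w + v] and [M'] bounds [w' - v];
    such a [c] exists because [M + M'] bounds [w + w']. *)
Lemma dominated_extension B v : good B -> B 0 ->
  exists c, good [set u | exists t w, B w /\ u = w + t *: (v, c)].
Proof.
move=> [Bl Bd] B0.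
have BD u w : B u -> B w -> B (u + w).
  by move=> Bu Bw; rewrite -(scale1r u); exact: Bl.
have BZ a u : B u -> B (a *: u) by move=> Bu; rewrite -[_ *: _]addr0; exact: Bl.
pose L := [set s : R | exists w M, [/\ B w, P (w.1 - v, M) & s = w.2 - M]].
have LU s w M : L s -> B w -> P (w.1 + v, M) -> s <= M - w.2.
  move=> [w' [M' [Bw' Pw' ->]]] Bw Pw.
  have := PD Pw Pw'; rewrite -[X in P X]/(_ , _) /= addrACA subrr addr0.
  by move=> /(Bd _ _ _ (BD _ _ Bw Bw')) /=; lra.
have hsL : has_sup L.
  split.
    by have [M PM] := Ptotal (- v); exists (0 - M), 0, M; rewrite /= sub0r; split.
  have [M PM] := Ptotal v; exists (M - 0) => s Ls.
  by apply: (LU s 0 M) => //=; rewrite add0r.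
pose c := sup L.
have cge w M : B w -> P (w.1 - v, M) -> w.2 - M <= c.
  by move=> Bw Pw; apply: ub_le_sup; [case: hsL|exists w, M].
have cle w M : B w -> P (w.1 + v, M) -> c <= M - w.2.
  by move=> Bw Pw; apply: ge_sup => [|s Ls]; [case: hsL|exact: LU].
exists c; split.
  move=> a _ _ [t [w [Bw ->]]] [t' [w' [Bw' ->]]].
  exists (a * t + t'), (a *: w + w'); split; first exact: Bl.
  by rewrite scalerDr scalerA scalerDl addrACA.
move=> x r M [t [w [Bw [-> ->]]]] PM.
have [t0|t0|t0] := ltgtP t 0.
- have it : 0 < (- t)^-1 by rewrite invr_gt0 oppr_gt0.
  have := cge _ ((- t)^-1 * M) (BZ (- t)^-1 _ Bw).
  have := PZ it PM; rewrite -[X in P X]/(_, _) /= scalerDr scalerA.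
  rewrite (_ : (- t)^-1 * t = - 1) ?scaleN1r; last by rewrite invrN mulNr mulVf ?lt_eqF.
  move=> /[swap]/[apply].
  rewrite -[_ *: w.2]/(_ * w.2) -mulrBr ler_pdivrMl ?oppr_gt0//.
  by rewrite -[t *: c]/(t * c); lra.
- have it : 0 < t^-1 by rewrite invr_gt0.
  have := cle _ (t^-1 * M) (BZ t^-1 _ Bw).
  have := PZ it PM; rewrite -[X in P X]/(_, _) /= scalerDr scalerA.
  rewrite mulVf ?gt_eqF// scale1r => /[swap]/[apply].
  rewrite -[t^-1 *: w.2]/(t^-1 * w.2) -mulrBr ler_pdivlMl//.
  by rewrite -[t *: c]/(t * c); lra.
- move: PM; rewrite t0 !scale0r !addr0 => PM.
  by apply: (Bd w.1) PM; case: w Bw {t0}.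
Qed.

(** Hahn-Banach theorem in conic form: [P (x, M)] reads as [M] bounds [x], and a
    linear relation bounded by [P] extends to a linear functional bounded by [P].
    For [P] the epigraph of a sublinear functional this is the usual theorem; the
    conic form also covers functionals that are only given as an infimum. *)
Theorem hahn_banach G : linear_relation G -> G 0 -> dominated P G ->
  exists phi : {scalar V},
    (forall x M, P (x, M) -> phi x <= M) /\ (forall x r, G (x, r) -> phi x = r).
Proof.
move=> Gl G0 Gd.
have [F FQ Ftot|A [[Al Ad] Amax]] := @Zorn_bigcup _ (fun A => good (G `|` A)).
  have common u v : (G `|` \bigcup_(X in F) X) u -> (G `|` \bigcup_(X in F) X) v ->
      exists X, [/\ good (G `|` X), X `<=` \bigcup_(X in F) X, (G `|` X) u & (G `|` X) v].
    have G00 : good (G `|` set0) by rewrite setU0.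
    move=> [Gu|[X FX Xu]] [Gv|[Y FY Yv]].
    - by exists set0; split=> //; left.
    - by exists Y; split; [exact: FQ|exact: bigcup_sup|left|right].
    - by exists X; split; [exact: FQ|exact: bigcup_sup|right|left].
    - have [XY|YX] := Ftot _ _ FX FY.
      + by exists Y; split; [exact: FQ|exact: bigcup_sup|right; exact: XY|right].
      + by exists X; split; [exact: FQ|exact: bigcup_sup|right|right; exact: YX].
  split.
    move=> a u v Hu Hv; have [X [[Xl _] XF Xu Xv]] := common _ _ Hu Hv.
    by have [?|/XF ?] := Xl a _ _ Xu Xv; [left|right].
  move=> x r M Hu; have [X [[_ Xd] _ Xu _]] := common _ _ Hu Hu.
  exact: Xd Xu.
pose B := G `|` A.
have B0 : B 0 by left.
have Bl : linear_relation B by [].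
have Bd : dominated P B by [].
have BZ a u : B u -> B (a *: u) by move=> Bu; rewrite -[_ *: _]addr0; exact: Bl.
have Btot x : exists r, B (x, r).
  have [c [Cl Cd]] := dominated_extension x (conj Bl Bd) B0.
  set C := (X in linear_relation X) in Cl; rewrite -/C in Cd.
  have BC : B `<=` C by move=> u Bu; exists 0, u; split; rewrite // scale0r addr0.
  have Cx : C (x, c) by exists 1, 0; rewrite scale1r add0r.
  exists c; apply: contrapT => nB.
  apply: (Amax C).
    split; last by move=> CA; apply: nB; right; exact: CA.
    by move=> u Au; apply: BC; right.
  by rewrite (_ : G `|` C = C)//; apply/setUidPr => u Gu; apply: BC; left.
have Bfun x r s : B (x, r) -> B (x, s) -> r = s.
  move=> Br Bs; have B' : B (0, r - s).
    have := Bl (- 1) _ _ Bs Br.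
    by rewrite -[X in B X]/(_, _) /= scaleN1r addrC subrr scaleN1r addrC.
  have [M PM] := Ptotal 0.
  apply/eqP; rewrite -subr_eq0; apply: contrapT => /negP rs.
  have := Bd 0 _ _ _ PM.
  have := BZ ((M + 1) / (r - s)) _ B'.
  rewrite -[X in B X]/(_, _) /= scaler0 => /[swap]/[apply].
  by rewrite -[_ *: _]/(_ * _) divfK//; lra.
pose h x : R := sval (cid (Btot x)).
have Bh x : B (x, h x) by exact: svalP (cid (Btot x)).
have hl : linear_for *%R h.
  move=> a x y; apply: (Bfun (a *: x + y)) => //.
  exact: (Bl a (x, h x) (y, h y)).
pose phi : {scalar V} := HB.pack h (GRing.isLinear.Build _ _ _ _ _ hl).
exists phi; split=> [x M|x r Gx]; first exact: Bd (Bh x).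
by apply: (Bfun x) => //; left.
Qed.

End cone.
End hahn_banach.

(** * Operators, Lipschitz maps and bounded functions *)

Section operator_norms.
Context {R : realType}.

Lemma bop_linear (E F : normedModType R) (T : bop E F) a x y :
  T (a *: x + y) = a *: T x + T y.
Proof. exact: linearP. Qed.

Lemma bopZ (E F : normedModType R) (T : bop E F) a x : T (a *: x) = a *: T x.
Proof. exact: linearZ. Qed.

Lemma bopB (E F : normedModType R) (T : bop E F) x y : T (x - y) = T x - T y.
Proof. exact: linearB. Qed.

Lemma bop_sumE (E F : normedModType R) (I : Type) (s : seq I) (T : I -> bop E F) x :
  (\sum_(i <- s) T i) x = \sum_(i <- s) T i x.
Proof.
elim: s => [|i s IH]; first by rewrite !big_nil.
by rewrite !big_cons -IH.
Qed.

Lemma bop_le (E F : normedModType R) (T : bop E F) x : `|T x| <= `|T| * `|x|.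
Proof.
have [->|x0] := eqVneq x 0; first by rewrite linear0 !normr0 mulr0.
have [M TM] := bop_bounded_ball T.
have : `|T (`|x|^-1 *: x)| <= `|T|.
  apply: (@sup_image_ub _ _ [set x | `|x| <= 1] (fun x => `|T x|) M).
    by move=> t /TM/andP[].
  by rewrite /= normrZ normfV normr_id mulVf// normr_eq0.
by rewrite linearZ/= normrZ normfV normr_id ler_pdivrMl ?normr_gt0// mulrC.
Qed.

Lemma bop_norm_le (E F : normedModType R) (T : bop E F) M : 0 <= M ->
  (forall x, `|T x| <= M * `|x|) -> `|T| <= M.
Proof.
move=> M0 TM; apply: sup_image_le => // x /= x1.
by rewrite (le_trans (TM x))// ler_piMr.
Qed.

Lemma bounded_linear_bop (E F : normedModType R) (g : {linear E -> F}) M :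
  (forall x, `|g x| <= M * `|x|) -> exists T : bop E F, T = g :> (E -> F).
Proof.
move=> gM; have gP : (g : E -> F) \in bop_pred E F.
  apply/asboolP; split; first exact: linearP.
  apply: bounded_linear_continuous; apply/linear_boundedP.
  apply: filterS (nbhs_pinfty_ge (num_real M)) => N MN x.
  by rewrite (le_trans (gM x))// ler_wpM2r.
by exists (MkBop gP).
Qed.

Lemma lip0_sumE (X Y : normedModType R) (I : Type) (s : seq I) (f : I -> lip0 X Y) x :
  (\sum_(i <- s) f i) x = \sum_(i <- s) f i x.
Proof.
elim: s => [|i s IH]; first by rewrite !big_nil.
by rewrite !big_cons -IH.
Qed.

Lemma lip0_le (X Y : normedModType R) (f : lip0 X Y) x y :
  `|f x - f y| <= `|f| * `|x - y|.
Proof.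
have [->|xy] := eqVneq x y; first by rewrite !subrr !normr0 mulr0.
have [M fM] := slope_norm_bounded f.
rewrite -ler_pdivrMr ?normr_gt0 ?subr_eq0//.
apply: (@sup_image_ub _ _ [set x | x.1 != x.2] (slope_norm f) M (x, y)) => //.
by move=> t /fM/andP[].
Qed.

Lemma lip0_norm_le (X Y : normedModType R) (f : lip0 X Y) M : 0 <= M ->
  (forall x y, `|f x - f y| <= M * `|x - y|) -> `|f| <= M.
Proof.
move=> M0 fM; apply: sup_image_le => // -[x y] /= xy.
by rewrite /slope_norm/= ler_pdivrMr// normr_gt0 subr_eq0.
Qed.

Lemma lip0_le0 (X Y : normedModType R) (f : lip0 X Y) x : `|f x| <= `|f| * `|x|.
Proof. by have := lip0_le f x 0; rewrite (lip0P f).2 !subr0. Qed.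

Lemma norming_functional (E : normedModType R) (y : E) :
  exists phi : dual_space E, `|phi| <= 1 /\ phi y = `|y|.
Proof.
pose G := [set u : E * R^o | exists a : R, u = a *: (y, `|y|)].
pose P := [set u : E * R^o | `|u.1| <= u.2].
have [||||||g [gP gG]] := @hahn_banach _ _ P _ _ _ G.
- by move=> u v Pu Pv; rewrite /P /= (le_trans (ler_normD _ _))// lerD.
- move=> a u a0 Pu; rewrite /P /= normrZ gtr0_norm//.
  by rewrite -[_ *: u.2]/(a * u.2) ler_pM2l.
- by move=> x; exists `|x|; rewrite /P /=.
- move=> a _ _ [b ->] [c ->]; exists (a * b + c).
  by rewrite scalerA -scalerDl.
- by exists 0; rewrite scale0r.
- move=> _ _ M [a [-> ->]]; rewrite /P /=; apply: le_trans.
  by rewrite normrZ ler_wpM2r// ler_norm.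
have gle x : `|g x| <= 1 * `|x|.
  rewrite mul1r ler_norml gP /P//= andbT lerNl -(linearN g).
  by apply: gP; rewrite /P /= normrN.
have [T TE] := bounded_linear_bop gle.
exists T; split; first by apply: bop_norm_le => // x; rewrite TE.
by rewrite TE; apply: gG; exists 1; rewrite scale1r.
Qed.

End operator_norms.

Section bounded_functions.
Context {R : realType} (T : Type).
Implicit Types h : T -> R^o.

Definition bfun_pred : {pred T -> R^o} :=
  fun h => `[< exists M : R, forall t, `|h t| <= M >].

Lemma bfun_submod : submod_closed bfun_pred.
Proof.
split; first by apply/asboolP; exists 0 => t; rewrite normr0.
move=> a h k /asboolP[M hM] /asboolP[N kN]; apply/asboolP.
exists (`|a| * M + N) => t; rewrite -[X in `|X|]/(a * h t + k t).
by rewrite (le_trans (ler_normD _ _))// normrM lerD// ler_wpM2l.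
Qed.

HB.instance Definition _ :=
  GRing.isSubmodClosed.Build R (T -> R^o) bfun_pred bfun_submod.

Record bfun := MkBfun { bfun_fun :> T -> R^o ; _ : bfun_fun \in bfun_pred }.

HB.instance Definition _ := [isSub for bfun_fun].
HB.instance Definition _ := [Choice of bfun by <:].
HB.instance Definition _ := [SubChoice_isSubLmodule of bfun by <:].

Lemma bfunP (h : bfun) : exists M : R, forall t, `|h t| <= M.
Proof. by case: h => h /= /asboolP. Qed.

Lemma bfun_ex h M : (forall t, `|h t| <= M) -> exists k : bfun, k = h :> (T -> R^o).
Proof.
by move=> hM; have hP : h \in bfun_pred by [apply/asboolP; exists M]; exists (MkBfun hP).
Qed.

Lemma bfunZE (a : R) (h : bfun) t : (a *: h) t = a * h t.
Proof. by []. Qed.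

Lemma bfunDE (h k : bfun) t : (h + k) t = h t + k t.
Proof. by []. Qed.

Lemma bfun_sumE (I : Type) (s : seq I) (F : I -> bfun) t :
  (\sum_(i <- s) F i) t = \sum_(i <- s) F i t.
Proof.
elim: s => [|i s IH]; first by rewrite !big_nil.
by rewrite !big_cons -IH.
Qed.

End bounded_functions.

(** * Domination of p-summing operators *)

Section pietsch.
Context {R : realType} {Z Y : normedModType R} (U : bop Z Y) (p C : R).
Hypotheses (p1 : 1 <= p) (C0 : 0 <= C).
Hypothesis UC : forall (n : nat) (z : 'I_n -> Z),
  (\sum_(i < n) `|U (z i)| `^ p) `^ p^-1 <=
  C * sup [set (\sum_(i < n) `|phi (z i)| `^ p) `^ p^-1 |
           phi in [set phi : dual_space Z | `|phi| <= 1]].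

Let p0 : 0 < p := ge1_gt0 p1.

(** Homogeneous form of p-summability: the supremum over the dual ball is replaced
    by an arbitrary upper bound, and the p-th roots are gone. *)
Lemma p_summing_seq (zs : seq Z) (K : R) :
  (forall phi : dual_space Z, `|phi| <= 1 ->
    C `^ p * \sum_(z <- zs) `|phi z| `^ p <= K) ->
  \sum_(z <- zs) `|U z| `^ p <= K.
Proof.
move=> H.
have K0 : 0 <= K.
  apply: le_trans (H 0 _); last by rewrite normr0.
  by rewrite mulr_ge0 ?powR_ge0 ?powR_sum_ge0.
have Kp0 : 0 <= K `^ p^-1 by exact: powR_ge0.
have := UC (fun i : 'I_(size zs) => zs`_i); set A := (X in X `^ _ <= _ -> _).
have AE : A = \sum_(z <- zs) `|U z| `^ p by rewrite (big_nth 0) big_mkord.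
have A0 : 0 <= A by exact: powR_sum_ge0.
rewrite -AE; set S := sup _ => AS.
suff : A `^ p^-1 <= K `^ p^-1.
  move=> /(ge0_ler_powR (ltW p0)); rewrite !nnegrE !powR_ge0 => /(_ isT isT).
  by rewrite -!powRrM !mulVf ?gt_eqF// !powRr1.
apply: (le_trans AS); move: (C0); rewrite le_eqVlt => /predU1P[<-|Cpos].
  by rewrite mul0r.
rewrite mulrC -ler_pdivlMr//; apply: sup_image_le; first by rewrite divr_ge0.
move=> phi /= phi1; rewrite ler_pdivlMr//.
have := H phi phi1; rewrite (big_nth 0) big_mkord mulrC.
set B := \sum_(_ < _) _ => BK.
have B0 : 0 <= B by exact: powR_sum_ge0.
have -> : B `^ p^-1 * C = (B * C `^ p) `^ p^-1.
  by rewrite powRM ?powR_ge0// -(powRrM C) mulfV ?gt_eqF// powRr1.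
by apply: ge0_ler_powR; rewrite ?nnegrE ?invr_ge0 ?mulr_ge0 ?powR_ge0 ?(ltW p0).
Qed.

Definition dual_ball := {phi : dual_space Z | `|phi| <= 1}.

(** A finitely additive form of Pietsch's domination theorem: [L] is a mean over
    the dual unit ball, defined on all bounded functions, in place of a measure on
    its weak-star compact topology. It is obtained by extending the zero functional below
    the sublinear functional
    [h |-> inf_zs sup_phi (h phi + \sum_(z <- zs) (C^p |phi z|^p - |U z|^p))],
    and p-summability of [U] says exactly that this is nonnegative at 0. *)
Lemma pietsch_domination : exists L : {scalar @bfun R dual_ball},
  (forall (h : @bfun R dual_ball) M, (forall t, h t <= M) -> L h <= M) /\
  (forall z (h : @bfun R dual_ball),
    (forall t, h t = C `^ p * `|sval t z| `^ p) -> `|U z| `^ p <= L h).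
Proof.
pose gap z (t : dual_ball) := `|U z| `^ p - C `^ p * `|sval t z| `^ p.
pose P := [set u : @bfun R dual_ball * R^o |
  exists zs, forall t, u.1 t <= u.2 + \sum_(z <- zs) gap z t].
have [||||||L [LP _]] := @hahn_banach _ _ P _ _ _ [set 0].
- move=> u v [zs uzs] [ws vws]; exists (zs ++ ws) => t.
  by rewrite big_cat addrACA; exact: (lerD (uzs t) (vws t)).
- move=> a u a0 [zs uzs]; exists [seq a `^ p^-1 *: z | z <- zs] => t.
  have gapZ z : gap (a `^ p^-1 *: z) t = a * gap z t.
    rewrite /gap !bopZ !normrZ (ger0_norm (powR_ge0 _ _)) !powRM ?powR_ge0//.
    by rewrite -powRrM mulVf ?gt_eqF// powRr1 ?(ltW a0)// mulrCA -mulrBr.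
  rewrite big_map (eq_bigr _ (fun z _ => gapZ z)) -mulr_sumr -mulrDr.
  by have -> : (a *: u).1 = a *: u.1 by []; rewrite bfunZE ler_pM2l.
- move=> h; have [M hM] := bfunP h; exists M, [::] => t.
  by rewrite big_nil addr0 (le_trans (ler_norm _)).
- by move=> a u v -> ->; rewrite scaler0 addr0.
- by [].
- move=> x r M [-> ->] [zs xzs].
  suff : \sum_(z <- zs) `|U z| `^ p <= M + \sum_(z <- zs) `|U z| `^ p.
    by rewrite lerDr.
  apply: p_summing_seq => phi phi1.
  have := xzs (exist _ phi phi1); rewrite /gap big_split/= sumrN -mulr_sumr.
  by rewrite -[X in X <= _ -> _]/(0 : R); lra.
exists L; split=> [h M hM|z h hE].
  by apply: LP; exists [::] => t /=; rewrite big_nil addr0.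
rewrite -lerN2 -linearN; apply: LP; exists [:: z] => t /=.
by rewrite big_seq1 /gap -[leLHS]/(- (h t)) hE; lra.
Qed.

End pietsch.

(** * Discretization of the dual ball *)

Section discretization.
Context {R : realType} {X Z : normedModType R} (S : lip0 X Z).
Hypothesis Scompact : lip_compact S.

Local Notation ball_dual := (@dual_ball R Z).
Local Notation St := (lip_transpose S).

Lemma slopes_net (e : R) : 0 < e -> exists ks : seq Z, forall x y, x != y ->
  exists2 k, k \in ks & `| `|x - y|^-1 *: (S x - S y) - k| <= e.
Proof.
move=> e0; have [A SA [Ac _]] := Scompact.
move: Ac; rewrite compact_cover => /(_ Z setT (fun z => ball z e)).
case=> [z _|z _|D _ AD]; first exact: ball_open.
  by exists z => //; exact: ballxx.
exists (finmap.enum_fset D) => x y xy.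
have /SA/AD[k kD] : [set `|x.1 - x.2|^-1 *: (S x.1 - S x.2) | x in
              [set x : X * X | x.1 != x.2]] (`|x - y|^-1 *: (S x - S y)).
  by exists (x, y).
rewrite -ball_normE /= distrC => /ltW ke; exists k => //; exact: kD.
Qed.

Lemma mixed_radix_lt (a N c M : nat) :
  (a < N)%N -> (c < M)%N -> (a * M + c < N * M)%N.
Proof.
move=> aN cM; apply: (@leq_trans (a.+1 * M)); last by rewrite leq_mul2r aN orbT.
by rewrite mulSnr ltn_add2l.
Qed.

(** The label of [t] lists the integer parts of [(t k + |k|) / e] for [k] in [ks],
    read as the digits of one number in a mixed radix system. *)
Lemma finite_labels (ks : seq Z) (e : R) : 0 < e ->
  exists N (lab : ball_dual -> nat), (forall t, lab t < N)%N /\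
    forall t u, lab t = lab u -> {in ks, forall k, `|sval t k - sval u k| <= e}.
Proof.
move=> e0; elim: ks => [|k ks [N [lab [labN labP]]]]; first by exists 1%N, (fun=> 0%N).
pose c (t : ball_dual) : nat := Num.truncn ((sval t k + `|k|) / e).
have tk (t : ball_dual) : `|sval t k| <= `|k|.
  by rewrite (le_trans (bop_le _ _))// ler_piMl//; exact: svalP t.
have cP (t : ball_dual) : (c t)%:R * e <= sval t k + `|k| < (c t).+1%:R * e.
  rewrite -ler_pdivlMr// -ltr_pdivrMr//; apply: truncn_itv.
  by rewrite divr_ge0 ?(ltW e0)//; have := tk t; rewrite ler_norml => /andP[]; lra.
pose M := (Num.truncn ((`|k| + `|k|) / e)).+1.
have cM t : (c t < M)%N.
  rewrite ltnS; apply: le_truncn; rewrite ler_pM2r ?invr_gt0// lerD2r.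
  by have := tk t; rewrite ler_norml => /andP[].
exists (N * M)%N, (fun t => lab t * M + c t)%N; split.
  by move=> t; exact: mixed_radix_lt.
move=> t u tu; have [labtu ctu] : lab t = lab u /\ c t = c u.
  split; first by have := congr1 (divn^~ M) tu; rewrite !divnMDl// !divn_small ?addn0.
  by have := congr1 (modn^~ M) tu; rewrite !modnMDl !modn_small.
move=> k'; rewrite inE => /predU1P[->|]; last exact: labP.
have := cP t; have := cP u; rewrite ctu -!natr1 !mulrDl mul1r => /andP[u1 u2] /andP[t1 t2].
by rewrite ler_norml; apply/andP; split; lra.
Qed.

(** Schauder's theorem for [S], in the form needed below: the transpose maps the
    dual unit ball to a totally bounded set. The ball is cut into finitely many
    cells, each with a representative, whose images have diameter at most [e]. *)
Lemma transpose_cells (e : R) : 0 < e ->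
  exists N (lab : ball_dual -> nat) (rep : nat -> dual_space Z),
    (forall t, lab t < N)%N /\ forall t, `|St (sval t - rep (lab t))| <= e.
Proof.
move=> e0; have e30 : 0 < e / 3 by rewrite divr_gt0.
have [ks ksP] := slopes_net e30; have [N [lab [labN labP]]] := finite_labels ks e30.
have close t u : lab t = lab u -> `|St (sval t - sval u)| <= e.
  move=> tu; apply: lip0_norm_le => [|x y]; first exact: ltW.
  have [->|xy] := eqVneq x y; first by rewrite !subrr !normr0 mulr0.
  have [k kks sk] := ksP x y xy.
  set s := _ *: _ in sk; pose d := sval t - sval u : dual_space Z.
  have dE : d (S x - S y) = `|x - y| * d s.
    by rewrite bopZ -[RHS]/(_ * (_ * _)) mulVKf// normr_eq0 subr_eq0.
  rewrite -[X in `|X| <= _]/(d (S x) - d (S y)) -bopB dE normrM normr_id mulrC ler_wpM2r//.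
  have d2 : `|d| <= 2.
    by rewrite (le_trans (ler_normB _ _))// (_ : 2 = 1 + 1 :> R)// lerD//; [exact: svalP t|exact: svalP u].
  have dk : `|d k| <= e / 3 by exact: labP tu _ kks.
  have -> : d s = d (s - k) + d k by rewrite bopB subrK.
  rewrite (le_trans (ler_normD _ _))//.
  have : `|d (s - k)| <= 2 * (e / 3).
    by rewrite (le_trans (bop_le _ _))// ler_pM.
  lra.
pose rep l := if pselect (exists t, lab t = l) is left H then sval (sval (cid H)) else 0.
exists N, lab, rep; split=> // t; rewrite /rep; case: pselect => [H|[]]; last by exists t.
by apply: close; rewrite (svalP (cid H)).
Qed.

Local Notation rad k := ((`|S| + 1) * 4^-1 ^+ k).

(** Telescoping through the representatives of finer and finer cells: the sum of
    the differences up to level [K] is the representative at that level. Level 0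
    is a single cell represented by 0, so that the sum starts at 0. *)
Lemma transpose_telescope :
  exists (N : nat -> nat) (sg : nat -> ball_dual -> nat) (D : nat -> nat -> dual_space Z),
  [/\ forall k t, (sg k t < N k)%N,
      forall k t, `|St (D k (sg k t))| <= 2 * rad k &
      forall K t, `|St (sval t - \sum_(0 <= k < K) D k (sg k t))| <= rad K].
Proof.
have S0 : 0 < `|S| + 1 by rewrite ltr_wpDl.
have rad0 k : 0 < rad k by rewrite mulr_gt0// exprn_gt0// invr_gt0.
pose level k (c : nat * (ball_dual -> nat) * (nat -> dual_space Z)) :=
  [/\ forall t, (c.1.2 t < c.1.1)%N,
      forall t, `|St (sval t - c.2 (c.1.2 t))| <= rad k &
      k = 0%N -> c.2 = fun=> 0].
have /choice[c cP] k : exists c, level k c.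
  case: k => [|k].
    exists (1%N, fun=> 0%N, fun=> 0); split=> // t /=.
    rewrite subr0 expr0 mulr1; apply: lip0_norm_le => [|x y]; first exact: ltW.
    rewrite -[X in `|X| <= _]/(sval t (S x) - sval t (S y)) -bopB (le_trans (bop_le _ _))//.
    apply: le_trans (_ : `|S x - S y| <= _); first by rewrite ler_piMl//; exact: svalP t.
    by rewrite (le_trans (lip0_le _ _ _))// ler_wpM2r// lerDl.
  have [N [lab [rep [labN repP]]]] := transpose_cells (rad0 k.+1).
  by exists (N, lab, rep).
pose N k := (c k).1.1; pose lab k := (c k).1.2; pose rep k := (c k).2.
have labN k t : (lab k t < N k)%N by have [H _ _] := cP k; exact: H.
have repP k t : `|St (sval t - rep k (lab k t))| <= rad k.
  by have [_ H _] := cP k; exact: H.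
pose D k s := rep k.+1 (s %/ N k)%N - rep k (s %% N k)%N.
pose sg k t := (lab k.+1 t * N k + lab k t)%N.
have DE k t : D k (sg k t) = rep k.+1 (lab k.+1 t) - rep k (lab k t).
  have Nk : (0 < N k)%N by exact: leq_ltn_trans (labN k t).
  by rewrite /D /sg divnMDl// modnMDl divn_small ?addn0 ?modn_small.
exists (fun k => N k.+1 * N k)%N, sg, D; split=> [k t|k t|K t].
- exact: mixed_radix_lt.
- have -> : D k (sg k t) = (sval t - rep k (lab k t)) - (sval t - rep k.+1 (lab k.+1 t)).
    by rewrite DE opprB [RHS]addrC addrA subrK.
  rewrite bopB (le_trans (ler_normB _ _))// mulrDl mul1r lerD//.
  apply: le_trans (repP _ _) _.
  by rewrite ler_pM2l// exprS ler_piMl ?exprn_ge0// invf_le1 ?ler1n.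
- rewrite (eq_bigr _ (fun k _ => DE k t)) telescope_sumr//.
  have [_ _ /(_ erefl)] := cP 0%N; rewrite -/(rep 0%N) => ->.
  by rewrite subr0.
Qed.

End discretization.

(** * Quasi p-nuclear estimates *)

Section quasi_nuclear.
Context {R : realType} {X Z Y : normedModType R} (S : lip0 X Z) (U : bop Z Y).
Variable p : R.
Hypotheses (p1 : 1 <= p) (Scompact : lip_compact S) (Usum : p_summing p U).

Let p0 : 0 < p := ge1_gt0 p1.
Local Notation St := (lip_transpose S).
Local Notation m := ((2 : R) `^ (p - 1)).
Local Notation rad k := ((`|S| + 1) * 4^-1 ^+ k).

Lemma powR_exprn (x : R) k : 0 <= x -> (x ^+ k) `^ p = (x `^ p) ^+ k.
Proof. by move=> x0; rewrite -[x ^+ k]powR_mulrn// powRAC powR_mulrn ?powR_ge0. Qed.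

(** Why the cells shrink like [4 ^ -k]: each splitting of a sum costs a factor
    [m = 2 ^ (p - 1)], and the p-th powers of the radii have to win against it. *)
Lemma level_ratio : m * 4^-1 `^ p <= 2^-1.
Proof.
have h0 : 0 <= (2^-1 : R) by rewrite invr_ge0.
rewrite (_ : 4^-1 = 2^-1 * 2^-1 :> R); last by lra.
rewrite powRM// mulrA.
have -> : m * 2^-1 `^ p = 2^-1.
  rewrite -[X in X `^ p]powR_inv1// -powRrM mulN1r -powRD ?pnatr_eq0 ?implybT//.
  by rewrite addrAC subrr add0r powR_inv1.
rewrite ler_piMr// -[leRHS](powRr0 (2^-1 : R)); apply: ger_powR; last exact: ltW.
by apply/andP; split; lra.
Qed.

Lemma level_bound (A : R) k : 0 <= A ->
  m ^+ k * (A * 4^-1 ^+ k) `^ p <= A `^ p * 2^-1 ^+ k.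
Proof.
move=> A0; rewrite powRM// ?exprn_ge0 ?invr_ge0// powR_exprn ?invr_ge0//.
rewrite mulrCA -exprMn ler_wpM2l ?powR_ge0// lerXn2r ?nnegrE ?mulr_ge0 ?powR_ge0 ?invr_ge0//.
exact: level_ratio.
Qed.

Lemma sum_half_le K : \sum_(0 <= k < K) (2^-1 : R) ^+ k <= 2.
Proof.
suff -> : \sum_(0 <= k < K) (2^-1 : R) ^+ k = 2 - 2 * 2^-1 ^+ K.
  by rewrite gerBl mulr_ge0// exprn_ge0// invr_ge0.
elim: K => [|K IH]; first by rewrite big_nil expr0; lra.
by rewrite big_nat_recr//= IH exprS; lra.
Qed.

(** Iterating [|u + v|^p <= m (|u|^p + |v|^p)]: the geometric weights [m ^+ k.+1]
    are harmless since the levels decay faster than [m ^+ k] grows. *)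
Lemma powR_norm_sum_le (a : nat -> R) r K :
  `|\sum_(0 <= k < K) a k + r| `^ p <=
  \sum_(0 <= k < K) m ^+ k.+1 * `|a k| `^ p + m ^+ K * `|r| `^ p.
Proof.
elim: K r => [|K IH] r; first by rewrite !big_nil !add0r mul1r.
rewrite !big_nat_recr//= -addrA (le_trans (IH _))// -addrA lerD2l.
by rewrite !exprSr -!mulrA -!mulrDr ler_wpM2l ?exprn_ge0 ?powR_ge0// powR_normD_le.
Qed.

(** A p-summing operator after a compact one is quasi p-nuclear (Persson-Pietsch).
    The bound on [|psi z|] holds on the span of [S X] and makes the error
    after [K] levels uniform in [phi].
    In the Pietsch inequality [|U z|^p <= L (phi |-> C^p |phi z|^p)], each [phi]
    is replaced by its telescoping series; as the terms take finitely many
    values [D k l], on cells of mass [nu k l], the mean becomes a sum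
    [\sum_(k, l) C^p m^(k+1) nu k l |D k l z|^p], and the pairs [(k, l)] are
    enumerated by [pickle]. *)
Theorem quasi_nuclear : exists G : nat -> dual_space Z,
  (exists B, forall N, \sum_(0 <= n < N) `|St (G n)| `^ p <= B) /\
  forall z M, (forall psi : dual_space Z, `|psi z| <= M * `|St psi|) ->
    forall e, 0 < e -> exists N, `|U z| `^ p <= \sum_(0 <= n < N) `|G n z| `^ p + e.
Proof.
have [C C0 UC] := Usum.
have [L [Lle Lpietsch]] := pietsch_domination p1 C0 UC.
have [Nk [sg [D [sgN Dle Dtele]]]] := transpose_telescope Scompact.
have m0 : 0 <= m by exact: powR_ge0.
have Cp0 : 0 <= C `^ p by exact: powR_ge0.
have S10 : 0 <= `|S| + 1 by rewrite addr_ge0.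
have Lmono (h h' : @bfun R (@dual_ball R Z)) (c : R) : (forall t, h t <= h' t + c) -> L h <= L h' + c.
  move=> hh'; rewrite -lerBlDl -linearB; apply: Lle => t.
  by rewrite -[leLHS]/(h t - h' t) lerBlDl.
have /choice[ind indE] (kl : nat * nat) : exists h : @bfun R (@dual_ball R Z),
    forall t, h t = (sg kl.1 t == kl.2)%:R.
  have [|h hE] := @bfun_ex R (@dual_ball R Z) (fun t => (sg kl.1 t == kl.2)%:R) 1.
    by move=> t; case: (_ == _); rewrite ?normr1 ?normr0.
  by exists h => t; rewrite hE.
pose nu kl := L (ind kl).
have nu0 kl : 0 <= nu kl.
  rewrite /nu -oppr_le0 -linearN; apply: Lle => t.
  by rewrite -[leLHS]/(- (ind kl t)) indE oppr_le0.
pose kappa kl := (C `^ p * m ^+ kl.1.+1 * nu kl) `^ p^-1.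
have kappaE kl : kappa kl `^ p = C `^ p * m ^+ kl.1.+1 * nu kl.
  by rewrite -powRrM mulVf ?gt_eqF// powRr1// !mulr_ge0 ?exprn_ge0.
pose G n := if pickle_inv n is Some kl then kappa kl *: D kl.1 kl.2 else 0 : dual_space Z.
pose B := C `^ p * m * (2 * (`|S| + 1)) `^ p * 2.
exists G; split.
  exists B => N.
  pose wt kl := C `^ p * m ^+ kl.1.+1 * `|St (D kl.1 kl.2)| `^ p.
  pose v n : @bfun R (@dual_ball R Z) :=
    if pickle_inv n is Some kl then wt kl *: ind kl else 0.
  have GL n : `|St (G n)| `^ p = L (v n).
    rewrite /G /v; case: pickle_inv => [kl|]; last first.
      by rewrite !linear0 normr0 powR0// gt_eqF.
    rewrite bopZ normrZ ger0_norm ?powR_ge0// powRM ?powR_ge0// kappaE linearZ/=.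
    by rewrite /wt -/(nu kl) mulrAC.
  rewrite (eq_bigr _ (fun n _ => GL n)) -linear_sum; apply: Lle => t.
  have wt0 kl : 0 <= wt kl by rewrite !mulr_ge0 ?exprn_ge0 ?powR_ge0.
  have vE n : v n t = if pickle_inv n is Some kl then wt kl * (sg kl.1 t == kl.2)%:R else 0.
    by rewrite /v; case: pickle_inv => [kl|//]; rewrite -[LHS]/(wt kl * ind kl t) indE.
  have v0 n : 0 <= v n t.
    by rewrite vE; case: pickle_inv => // kl; rewrite mulr_ge0.
  (* For a given t at most one cell per level contributes, so the mean is at
     most the geometric sum over the levels. *)
  pose K := (\max_(n < N) (oapp fst 0%N (pickle_inv n : option (nat * nat))).+1)%N.
  pose s := [seq pickle (k, sg k t) | k <- iota 0 K].
  have us : uniq s.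
    rewrite map_inj_uniq ?iota_uniq// => k k' /(pcan_inj pickleK) [] //.
  have -> : (\sum_(0 <= n < N) v n) t =
      \sum_(n <- [seq n <- index_iota 0 N | n \in s]) v n t.
    rewrite bfun_sumE big_filter [RHS]big_mkcond/= !big_nat; apply: eq_bigr => n nN.
    case: ifPn => // ns; rewrite vE; case E: pickle_inv => [[k l]|//] /=.
    case: eqVneq => [sl|]; last by rewrite mulr0.
    case/negP: ns; apply/mapP; exists k.
      rewrite mem_iota add0n /= /K.
      have /= := @leq_bigmax _ (fun n : 'I_N => (oapp fst 0%N (pickle_inv n : option (nat * nat))).+1) (Ordinal nN).
      by rewrite E.
    by rewrite sl -(pickle_invK (T := (nat * nat)%type) n) E.
  apply: (@le_trans _ _ (\sum_(n <- s) v n t)).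
    apply: ler_sum_subseq => //; first by rewrite filter_uniq// iota_uniq.
    by move=> n; rewrite mem_filter => /andP[].
  rewrite big_map.
  have step k : v (pickle (k, sg k t)) t <= C `^ p * m * (2 * (`|S| + 1)) `^ p * 2^-1 ^+ k.
    rewrite vE pickleK_inv /= eqxx mulr1 /wt /= exprS -!mulrA.
    have A0 : 0 <= 2 * (`|S| + 1) by rewrite mulr_ge0.
    rewrite !ler_wpM2l//; apply: le_trans (level_bound k A0).
    rewrite ler_wpM2l ?exprn_ge0//; apply: ge0_ler_powR; rewrite ?nnegrE ?(ltW p0)//.
    by rewrite -mulrA; exact: Dle.
  apply: le_trans (ler_sum _ (fun k _ => step k)) _.
  rewrite -mulr_sumr ler_wpM2l ?mulr_ge0 ?powR_ge0//.
  by have := sum_half_le K; rewrite /index_iota subn0.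
move=> z M zM e e0.
have M0 : 0 <= `|M| by [].
pose A := C `^ p * (`|M| * (`|S| + 1)) `^ p.
have A0 : 0 <= A by rewrite mulr_ge0 ?powR_ge0.
have [K AK] : exists K, A * 2^-1 ^+ K <= e.
  have : (fun K => A * 2^-1 ^+ K) @ \oo --> A * 0.
    by apply: cvgMr; apply: cvg_expr; rewrite ger0_norm; lra.
  rewrite mulr0 => /cvgrPdist_le /(_ e e0)[K _ /(_ K (leqnn K))].
  rewrite sub0r normrN ger0_norm; first by exists K.
  by rewrite mulr_ge0// exprn_ge0// invr_ge0.
have [h hE] : exists h : @bfun R (@dual_ball R Z), forall t, h t = C `^ p * `|sval t z| `^ p.
  have [|h hE] := @bfun_ex R (@dual_ball R Z) (fun t => C `^ p * `|sval t z| `^ p) (C `^ p * `|z| `^ p).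
    move=> t; rewrite ger0_norm ?mulr_ge0 ?powR_ge0// ler_wpM2l//.
    apply: ge0_ler_powR; rewrite ?nnegrE ?(ltW p0)//.
    by rewrite (le_trans (bop_le _ _))// ler_piMl//; exact: svalP t.
  by exists h => t; rewrite hE.
pose wt k l := C `^ p * m ^+ k.+1 * `|D k l z| `^ p.
pose h' := \sum_(0 <= k < K) \sum_(0 <= l < Nk k) wt k l *: ind (k, l).
have Lh' : L h' = \sum_(0 <= k < K) \sum_(0 <= l < Nk k) `|G (pickle (k, l)) z| `^ p.
  rewrite linear_sum; apply: eq_bigr => k _; rewrite linear_sum; apply: eq_bigr => l _.
  rewrite linearZ/= /G pickleK_inv -[in RHS]/(kappa (k, l) *: (D k l z)) normrZ.
  rewrite ger0_norm ?powR_ge0// powRM ?powR_ge0// kappaE.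
  by rewrite /wt -/(nu (k, l)) mulrAC.
have h'E t : h' t = \sum_(0 <= k < K) wt k (sg k t).
  rewrite bfun_sumE; apply: eq_bigr => k _; rewrite bfun_sumE.
  transitivity (\sum_(0 <= l < Nk k | l == sg k t) wt k l).
    rewrite [RHS]big_mkcond; apply: eq_bigr => l _.
    rewrite -[LHS]/(wt k l * ind (k, l) t) indE /= eq_sym.
    by case: eqP => _; rewrite ?mulr1 ?mulr0.
  by rewrite big_nat1_eq sgN.
have hh' t : h t <= h' t + e.
  rewrite hE h'E.
  set r := sval t z - \sum_(0 <= k < K) D k (sg k t) z.
  have rE : sval t z = \sum_(0 <= k < K) D k (sg k t) z + r by rewrite /r addrC subrK.
  have rle : `|r| <= `|M| * (`|S| + 1) * 4^-1 ^+ K.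
    rewrite /r -bop_sumE -[X in `|X|]/((sval t - \sum_(0 <= k < K) D k (sg k t)) z).
    apply: le_trans (zM _) _; apply: le_trans (ler_wpM2r _ (ler_norm M)) _ => //.
    by rewrite -mulrA ler_wpM2l//; exact: Dtele.
  rewrite {1}rE; apply: le_trans (ler_wpM2l Cp0 (powR_norm_sum_le _ _ _)) _.
  rewrite mulrDr mulr_sumr; apply: lerD.
    by apply: ler_sum => k _; rewrite /wt mulrA.
  apply: le_trans AK; rewrite -mulrA ler_wpM2l//.
  have MS0 : 0 <= `|M| * (`|S| + 1) by rewrite mulr_ge0.
  apply: le_trans (level_bound K MS0); rewrite ler_wpM2l ?exprn_ge0//.
  by apply: ge0_ler_powR rle; rewrite ?nnegrE ?(ltW p0)// mulr_ge0// exprn_ge0// invr_ge0.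
(* The finitely many pairs in use are among the first indices. *)
pose s := [seq pickle (k, l) | k <- index_iota 0 K, l <- index_iota 0 (Nk k)].
exists (\max_(n <- s) n).+1.
have Uh : `|U z| `^ p <= L h by exact: Lpietsch.
apply: le_trans Uh _; apply: le_trans (Lmono _ _ _ hh') _; rewrite lerD2r Lh'.
have -> : \sum_(0 <= k < K) \sum_(0 <= l < Nk k) `|G (pickle (k, l)) z| `^ p =
    \sum_(n <- s) `|G n z| `^ p by rewrite big_allpairs_dep.
apply: ler_sum_subseq => [n| | |n ns]; rewrite ?powR_ge0 ?iota_uniq//.
  apply: allpairs_uniq_dep; [exact: iota_uniq|by move=> k _; exact: iota_uniq|].
  by move=> [k l] [k' l'] _ _ /= /(pcan_inj pickleK) [-> ->].
by rewrite mem_index_iota /= ltnS; exact: leq_bigmax_seq.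
Qed.

End quasi_nuclear.

(** * From quasi p-nuclear estimates to p-compact transposes *)

Section duality.
Context {R : realType} {X Z Y : normedModType R}.
Variables (S : lip0 X Z) (U : bop Z Y) (f : lip0 X Y) (p : R).
Hypotheses (p1 : 1 <= p) (fE : f = U \o S :> (X -> Y)).

Let p0 : 0 < p := ge1_gt0 p1.
Local Notation St := (lip_transpose S).

Variables (G : nat -> dual_space Z) (B : R).
Local Notation c n := `|St (G n)|.
Hypothesis cB : forall N, \sum_(0 <= n < N) c n `^ p <= B.
Hypothesis UG : forall z M, (forall psi : dual_space Z, `|psi z| <= M * `|St psi|) ->
  forall e, 0 < e -> exists N, `|U z| `^ p <= \sum_(0 <= n < N) `|G n z| `^ p + e.

Local Notation bseq := (@bfun R nat).

(** The estimate on [U] makes [(G n z)_n |-> phi (U z)] a functional of norm at most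
    one for the p-norm; its Hahn-Banach extension is given by a sequence [a] in the
    unit ball of the dual sequence space. The sequences are divided by the norms
    [c n] to make them bounded, which turns the p-norm into a weighted one, and the
    weights give the uniform tail estimate behind convergence in Lipschitz norm. *)
Lemma transpose_expansion (phi : dual_space Y) : `|phi| <= 1 ->
  exists a, lp_ball (hoelder_conjugate p%:E) a /\
    [series a n *: St (G n)]_n @ \oo --> lip_transpose f phi.
Proof.
move=> phi1.
pose Gr := [set u : bseq * R^o | exists z,
  [/\ exists M, forall psi : dual_space Z, `|psi z| <= M * `|St psi|,
      forall n, G n z = c n * u.1 n & u.2 = phi (U z)]].
pose P := [set u : bseq * R^o |
  0 < u.2 /\ forall N, \sum_(0 <= n < N) `|c n * u.1 n| `^ p <= u.2 `^ p].
have [||||||lam [lamP lamG]] := @hahn_banach _ _ P _ _ _ Gr.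
- move=> u v [u0 uP] [v0 vP]; split; first exact: addr_gt0.
  move=> N; apply: le_trans (minkowski_le p1 u0 v0 (uP N) (vP N)).
  by apply: ler_sum => n _; rewrite -mulrDr.
- move=> s u s0 [u0 uP]; split; first exact: mulr_gt0.
  move=> N; rewrite -[leRHS]/((s * u.2) `^ p) powRM ?(ltW s0) ?(ltW u0)//.
  apply: le_trans (ler_wpM2l (powR_ge0 _ _) (uP N)); rewrite mulr_sumr.
  apply: ler_sum => n _; rewrite (_ : (s *: u).1 = s *: u.1)// bfunZE mulrCA normrM powRM//.
  by rewrite gtr0_norm.
- move=> h; have [K hK] := bfunP h.
  have K0 : 0 <= K by exact: le_trans (hK 0%N).
  have B0 : 0 <= B by have := cB 0; rewrite big_nil.
  have T0 : 0 < K `^ p * B + 1 by rewrite ltr_wpDl// mulr_ge0 ?powR_ge0.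
  exists ((K `^ p * B + 1) `^ p^-1); split; first exact: powR_gt0.
  move=> N /=; rewrite -powRrM mulVf ?gt_eqF// powRr1 ?(ltW T0)//.
  apply: (@le_trans _ _ (K `^ p * B)); last by rewrite lerDl.
  apply: le_trans (ler_wpM2l (powR_ge0 _ _) (cB N)); rewrite mulr_sumr.
  apply: ler_sum => n _; rewrite mulrC normrM powRM// normr_id.
  rewrite ler_wpM2r ?powR_ge0//.
  by apply: ge0_ler_powR (hK n); rewrite ?nnegrE ?(ltW p0).
- move=> s u v [z [[M zM] zu uz]] [w [[M' wM] wv vw]]; exists (s *: z + w); split.
  + exists (`|s| * M + M') => psi.
    rewrite bop_linear (le_trans (ler_normD _ _))// mulrDl lerD ?wM//.
    by rewrite normrZ -mulrA ler_wpM2l//; exact: zM.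
  + move=> n; rewrite bop_linear zu wv.
    rewrite (_ : (s *: u + v).1 = s *: u.1 + v.1)// bfunDE bfunZE mulrDr.
    by rewrite -[_ *: _]/(s * _) mulrCA.
  + rewrite !bop_linear.
    by rewrite -[LHS]/(s * u.2 + v.2) uz vw.
- exists 0; split; first by exists 0 => psi; rewrite linear0 normr0 mul0r.
  + by move=> n; rewrite linear0 -[X in c n * X]/(0 : R) mulr0.
  + by rewrite !linear0.
- (* Comparing p-th powers absorbs the error e of the estimate on U. *)
  move=> h r M [z [[K zK] /= zh rE]] [/= M0 hM].
  rewrite leNgt; apply/negP => Mr.
  have rU : r `^ p <= `|U z| `^ p.
    apply: ge0_ler_powR; rewrite ?nnegrE ?(ltW p0) ?(ltW (lt_trans M0 Mr))//.
    rewrite rE (le_trans (ler_norm _))// (le_trans (bop_le _ _))// ler_piMl//.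
  have : M `^ p < r `^ p.
    by apply: gt0_ltr_powR; rewrite ?nnegrE ?(ltW M0) ?(ltW (lt_trans M0 Mr)).
  rewrite -subr_gt0 => rM.
  have /(UG zK)[N] : 0 < (r `^ p - M `^ p) / 2 by rewrite divr_gt0.
  have := hM N.
  rewrite (eq_bigr (fun n => `|G n z| `^ p)) => [|n _]; last by rewrite zh.
  lra.
have /choice[delta deltaE] n : exists h : bseq, forall k, h k = (k == n)%:R.
  have [|h hE] := @bfun_ex R nat (fun k => (k == n)%:R) 1.
    by move=> k; case: (_ == _); rewrite ?normr1 ?normr0.
  by exists h => k; rewrite hE.
have lamP' (h : bseq) (t : R) : 0 < t -> (forall N, \sum_(0 <= n < N) `|c n * h n| `^ p <= t `^ p) ->
    lam h <= t.
  by move=> t0 ht; apply: lamP; split.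
(* If c n = 0 the functional vanishes on delta n, in accordance with a n = 0. *)
pose a n := lam (delta n) / c n.
have lam_delta n : lam (delta n) = a n * c n.
  have [cn0|cn0] := eqVneq (c n) 0; last by rewrite /a divfK.
  rewrite cn0 mulr0; apply/eqP; rewrite eq_le; apply/andP; split.
    apply/ler_addgt0Pr => e e0; rewrite add0r; apply: lamP' => // N.
    rewrite big1 ?powR_ge0// => k _; rewrite deltaE.
    by case: eqP => [->|_]; rewrite ?cn0 ?mul0r ?mulr0 normr0 powR0 ?gt_eqF.
  rewrite -oppr_le0 -linearN.
  apply/ler_addgt0Pr => e e0; rewrite add0r; apply: lamP' => // N.
  rewrite big1 ?powR_ge0// => k _; rewrite -[X in _ * X]/(- delta n k) deltaE.
  by case: eqP => [->|_]; rewrite ?cn0 ?mul0r ?oppr0 ?mulr0 normr0 powR0 ?gt_eqF.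
pose fin N (x : nat -> R) := \sum_(0 <= k < N) x k *: delta k.
have finE N x n : fin N x n = if (n < N)%N then x n else 0.
  rewrite bfun_sumE.
  transitivity (\sum_(0 <= k < N | k == n) x k); last by rewrite big_nat1_eq.
  rewrite [RHS]big_mkcond; apply: eq_bigr => k _.
  rewrite -[LHS]/(x k * delta k n) deltaE eq_sym.
  by case: eqP => _; rewrite ?mulr1 ?mulr0.
have lam_fin N x : lam (fin N x) = \sum_(0 <= k < N) a k * (c k * x k).
  rewrite linear_sum; apply: eq_bigr => k _.
  by rewrite linearZ/= lam_delta mulrC mulrA.
exists a; split.
  apply/(lp_ballP _ p1) => N b.
  apply/ler_addgt0Pr => e e0; set T := _ `^ p^-1.
  have T0 : 0 <= T by exact: powR_ge0.
  have -> : \sum_(0 <= n < N) a n * b n = lam (fin N (fun n => b n / c n)).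
    rewrite lam_fin; apply: eq_bigr => n _.
    have [cn0|cn0] := eqVneq (c n) 0; last by rewrite [c n * _]mulrC divfK.
    by rewrite /a cn0 invr0 !mulr0 !mul0r.
  apply: lamP'; first by rewrite ltr_wpDl.
  move=> N'; apply: (@le_trans _ _ (T `^ p)); last first.
    apply: ge0_ler_powR; rewrite ?nnegrE ?(ltW p0)// ?lerDl ?(ltW e0)//.
    by rewrite addr_ge0// ltW.
  rewrite -powRrM mulVf ?gt_eqF// powRr1 ?powR_sum_ge0//.
  apply: ler_sum_support => [n|n nN|n nN]; first exact: powR_ge0.
    rewrite finE nN; have [cn0|cn0] := eqVneq (c n) 0.
      by rewrite cn0 mul0r normr0 powR0 ?gt_eqF// powR_ge0.
    by rewrite mulrC divfK.
  by rewrite finE ltnNge nN mulr0 normr0 powR0 ?gt_eqF.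
apply/cvgrPdist_le => e e0.
have [N0 N0P] := tail_sum_le (fun n => powR_ge0 (c n) p) cB (powR_gt0 p e0).
exists N0 => // N /= N0N; apply: lip0_norm_le => [|x y]; first exact: ltW.
have [->|xy] := eqVneq x y; first by rewrite !subrr !normr0 mulr0.
have xy0 : 0 < `|x - y| by rewrite normr_gt0 subr_eq0.
pose z := S x - S y.
have psiz (psi : dual_space Z) : psi z = St psi x - St psi y by rewrite bopB.
have zK (psi : dual_space Z) : `|psi z| <= `|x - y| * `|St psi|.
  by rewrite psiz mulrC lip0_le.
have [h hE] : exists h : bseq, forall n, h n = G n z / c n.
  have [|h hE] := @bfun_ex R nat (fun n => G n z / c n) `|x - y|.
    move=> n; rewrite normrM normfV normr_id.
    have [->|cn0] := eqVneq (c n) 0; first by rewrite invr0 mulr0.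
    by rewrite ler_pdivrMr ?lt0r ?cn0 ?normr_ge0//; exact: zK.
  by exists h => n; rewrite hE.
have ch n : G n z = c n * h n.
  rewrite hE; have [cn0|cn0] := eqVneq (c n) 0; last by rewrite mulrC divfK.
  by have := zK (G n); rewrite cn0 mul0r mulr0 normr_le0 => /eqP.
have lamh : lam h = phi (f x) - phi (f y).
  rewrite (lamG h (phi (U z))); last by exists z; split; [exists `|x - y| | |].
  by rewrite /z !bopB fE.
have tE w : (lip_transpose f phi - [series a n *: St (G n)]_n N) w =
            phi (f w) - \sum_(0 <= k < N) a k * G k (S w).
  by rewrite -[LHS]/(phi (f w) - (\sum_(0 <= k < N) a k *: St (G k)) w) lip0_sumE.
have aG : \sum_(0 <= k < N) a k * (c k * h k) =
    \sum_(0 <= k < N) a k * G k (S x) - \sum_(0 <= k < N) a k * G k (S y).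
  by rewrite -sumrB; apply: eq_bigr => k _; rewrite -mulrBr -ch /z bopB.
have -> : (lip_transpose f phi - [series a n *: St (G n)]_n N) x -
          (lip_transpose f phi - [series a n *: St (G n)]_n N) y = lam (h - fin N h).
  by rewrite [RHS]linearB lam_fin lamh aG !tE; lra.
have et0 : 0 < e * `|x - y| by exact: mulr_gt0.
have bound (k : bseq) : (forall n, `|k n| = if (n < N)%N then 0 else `|h n|) ->
    lam k <= e * `|x - y|.
  move=> kE; apply: lamP' => // M; rewrite powRM ?(ltW e0)//.
  pose u n := if (n < N)%N then 0 else c n `^ p.
  apply: (@le_trans _ _ (\sum_(0 <= n < M) u n * `|x - y| `^ p)).
    apply: ler_sum => n _; rewrite normrM normr_id kE /u.
    case: ifP => _; first by rewrite mulr0 mul0r powR0 ?gt_eqF.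
    rewrite -powRM//; apply: ge0_ler_powR; rewrite ?nnegrE ?(ltW p0) ?mulr_ge0//.
    by rewrite -[X in X * _]normr_id -normrM -ch mulrC; exact: zK.
  rewrite -mulr_suml ler_wpM2r ?powR_ge0//.
  have [MN|/ltnW NM] := leqP M N.
    rewrite big_nat_cond big1 ?powR_ge0// => n /andP[/andP[_ nM] _].
    by rewrite /u (leq_trans nM MN).
  rewrite (big_cat_nat (n := N))//= [X in X + _]big_nat_cond [X in X + _]big1; last first.
    by move=> n /andP[/andP[_ nN] _]; rewrite /u nN.
  rewrite add0r; apply: le_trans (N0P N M N0N); apply: ler_sum => n _.
  by rewrite /u; case: ifP.
rewrite ler_norml bound ?andbT => [|n]; last first.
  rewrite -[X in `|X|]/(h n - fin N h n) finE.
  by case: ifP; rewrite ?subrr ?subr0// normr0.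
rewrite lerNl -linearN; apply: bound => n.
rewrite -[X in `|X|]/(- (h n - fin N h n)) finE normrN.
by case: ifP; rewrite ?subrr ?subr0// normr0.
Qed.

Lemma lip_dual_p_compact_of_quasi_nuclear : lip_dual_p_compact p f.
Proof.
move=> A [M0 [_ AM]].
pose M := Num.max M0 0 + 1.
have Mpos : 0 < M by rewrite ltr_wpDl// le_max lexx orbT.
have phiM phi : A phi -> `|phi| <= M.
  by move=> Aphi; apply: AM => //; rewrite /M ltr_pwDr// le_max lexx.
exists (fun n => M *: St (G n)); split.
  apply/nneseries_ltyP => [n|]; first exact: powR_ge0.
  exists (M `^ p * B) => N.
  apply: le_trans (ler_wpM2l (powR_ge0 _ _) (cB N)); rewrite mulr_sumr.
  apply: ler_sum => n _.
  by rewrite normrZ powRM// (gtr0_norm Mpos).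
move=> _ [phi Aphi <-].
have phi1 : `|M^-1 *: phi| <= 1.
  by rewrite normrZ normfV (gtr0_norm Mpos) ler_pdivrMl// mulr1; exact: phiM.
have [a [a1 acvg]] := transpose_expansion phi1; exists a => //.
have -> : lip_transpose f phi = M *: lip_transpose f (M^-1 *: phi).
  by rewrite -[RHS]bopZ scalerA divff ?gt_eqF// scale1r.
have -> : [series a n *: (M *: St (G n))]_n = (fun N => M *: [series a n *: St (G n)]_n N).
  apply/funext => N; rewrite /series /= scaler_sumr; apply: eq_bigr => n _.
  by rewrite !scalerA mulrC.
exact: cvgZr.
Qed.

End duality.

(** * Complete spaces of pairs (bounded sequence, vector) *)

Section filters.

Lemma near_lim_dist_le (R : realType) (T : Type) (F : set_system T) (V : normedModType R) (g : T -> V)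
    (x l : V) (P : set T) (e : R) : ProperFilter F -> g t @[t --> F] --> l -> F P ->
  (forall t, P t -> `|x - g t| <= e) -> `|x - l| <= e.
Proof.
move=> FF gl FP xg; apply/ler_addgt0Pr => d d0.
have /cvgrPdist_lt/(_ d d0) Fd := gl.
have [t [Pt lt]] := @filter_ex _ F _ _ (filterI FP Fd).
rewrite -(subrKA (g t)) (le_trans (ler_normD _ _))// lerD ?xg//.
by rewrite distrC ltW.
Qed.

Lemma ultra_fmap (T V : Type) (g : T -> V) (F : set_system T) :
  UltraFilter F -> UltraFilter (g @ F).
Proof.
move=> FU; split; first exact: fmap_proper_filter.
move=> G GG FG; apply/seteqP; split=> // B GB.
have [//|FB] := in_ultra_setVsetC (g @^-1` B) FU.
have /(filterI GB) : G (~` B) by apply: FG.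
by rewrite setICr => /filter_not_empty.
Qed.

End filters.

Section graph_space.
Context {R : realType} (Y : completeNormedModType R).
Variable A : set (dual_space Y * (nat -> R))%type.

Definition graph_pred : {pred (nat -> R^o) * Y} := fun u =>
  `[< (exists M : R, forall n, `|u.1 n| <= M) /\
      forall phi b, A (phi, b) -> (exists D, forall N, \sum_(0 <= n < N) `|b n| <= D) ->
        [series b n * u.1 n]_n @ \oo --> phi u.2 >].

Lemma graph_submod : submod_closed graph_pred.
Proof.
split.
  apply/asboolP; split; first by exists 0 => n; rewrite normr0.
  move=> phi b _ _; rewrite [X in _ --> X](linear0 phi).
  have -> : [series b n * (0 : (nat -> R^o) * Y).1 n]_n = fun=> 0.
    apply/funext => N; rewrite /series /= big1// => n _.
    by rewrite -[X in _ * X]/(0 : R) mulr0.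
  exact: cvg_cst.
move=> a u v /asboolP[[M uM] ucvg] /asboolP[[N vN] vcvg]; apply/asboolP; split.
  exists (`|a| * M + N) => n; rewrite -[X in `|X|]/(a * u.1 n + v.1 n).
  by rewrite (le_trans (ler_normD _ _))// normrM lerD// ler_wpM2l.
move=> phi b Ab bD; rewrite [X in _ --> X]bop_linear.
have -> : [series b n * (a *: u + v).1 n]_n =
    (fun N => a * [series b n * u.1 n]_n N) + [series b n * v.1 n]_n.
  apply/funext => K.
  rewrite -[RHS]/(a * (\sum_(0 <= n < K) b n * u.1 n) + \sum_(0 <= n < K) b n * v.1 n).
  rewrite mulr_sumr -big_split.
  apply: eq_bigr => n _ /=.
  by rewrite -[X in _ * X]/(a * u.1 n + v.1 n) mulrDr mulrCA.
by apply: cvgD; [apply: cvgMr; exact: (ucvg _ _ Ab bD)|exact: (vcvg _ _ Ab bD)].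
Qed.

HB.instance Definition _ :=
  GRing.isSubmodClosed.Build R ((nat -> R^o) * Y)%type graph_pred graph_submod.

(** Pairs [(z, y)] of a bounded sequence and a vector of [Y] such that [phi y] is
    the sum of [b n * z n] for the prescribed pairs [(phi, b)]. When the
    functionals [phi] separate points this is the graph of an operator from a
    space of bounded sequences to [Y], with the graph norm; working with the graph
    makes the operator a projection, which replaces an extension by density.
    Restricting to summable [b] makes the defining conditions closed. *)
Record graph_space := MkGraph {
  graph_val :> ((nat -> R^o) * Y)%type ; _ : graph_val \in graph_pred }.

HB.instance Definition _ := [isSub for graph_val].
HB.instance Definition _ := [Choice of graph_space by <:].
HB.instance Definition _ := [SubChoice_isSubLmodule of graph_space by <:].

Implicit Types u v : graph_space.

Lemma graphP u : (exists M : R, forall n, `|u.1 n| <= M) /\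
  forall phi b, A (phi, b) -> (exists D, forall N, \sum_(0 <= n < N) `|b n| <= D) ->
    [series b n * u.1 n]_n @ \oo --> phi u.2.
Proof. by case: u => u /= /asboolP. Qed.

(* The two components are normed by one supremum, with [Y] at index 0. *)
Definition graph_coord u n : R := if n is n'.+1 then `|u.1 n'| else `|u.2|.

Definition graph_norm u : R := sup [set graph_coord u n | n in setT].

Lemma graph_coord_bounded u : exists M, forall n, setT n -> 0 <= graph_coord u n <= M.
Proof.
have [[M uM] _] := graphP u; exists (Num.max M `|u.2|) => -[|n] _ /=.
  by rewrite normr_ge0 le_max lexx orbT.
by rewrite normr_ge0 le_max uM.
Qed.

Lemma graph_normD u v : graph_norm (u + v) <= graph_norm u + graph_norm v.
Proof.
have [M uM] := graph_coord_bounded u; have [N vN] := graph_coord_bounded v.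
by apply: (sup_imageD uM vN) => -[|n] _; [exact: (ler_normD u.2)|exact: (ler_normD (u.1 n))].
Qed.

Lemma graph_normZ (l : R) u : graph_norm (l *: u) = `|l| * graph_norm u.
Proof.
have [M uM] := graph_coord_bounded u.
apply: (sup_imageZ _ uM) => // -[|n] _; first exact: (normrZ l u.2).
exact: (normrM l (u.1 n)).
Qed.

Lemma graph_norm_ub u n : graph_coord u n <= graph_norm u.
Proof.
have [M uM] := graph_coord_bounded u.
by apply: (@sup_image_ub _ _ setT (graph_coord u) M) => // t /uM/andP[].
Qed.

Lemma graph_norm0_eq0 u : graph_norm u = 0 -> u = 0.
Proof.
move=> u0; have c0 n : graph_coord u n <= 0 by rewrite -u0 graph_norm_ub.
apply/val_inj => /=; rewrite [LHS]surjective_pairing -[RHS]/((0 : nat -> R^o), (0 : Y)).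
congr (_, _); last by apply/eqP; rewrite -normr_le0; exact: (c0 0%N).
by apply/funext => n; apply/eqP; rewrite -normr_le0; exact: (c0 n.+1).
Qed.

HB.instance Definition _ := Lmodule_isNormed.Build R graph_space
  graph_normD graph_normZ graph_norm0_eq0.

Lemma graph_seq_le u n : `|u.1 n| <= `|u|. Proof. exact: (graph_norm_ub u n.+1). Qed.

Lemma graph_vec_le u : `|u.2| <= `|u|. Proof. exact: (graph_norm_ub u 0). Qed.

Lemma graph_norm_le u M : (forall n, `|u.1 n| <= M) -> `|u.2| <= M -> `|u| <= M.
Proof.
move=> u1 u2; apply: sup_image_le => [|[|n] _]; [exact: le_trans u2|exact: u2|exact: u1].
Qed.

Lemma graph_complete (F : set_system graph_space) :
  ProperFilter F -> cauchy F -> cvg F.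
Proof.
move=> FF /cauchy_ballP Fc.
have small e : 0 < e -> exists2 P, F P & forall u v, P u -> P v -> `|u - v| <= e.
  move=> e0; have [[P Q] /= [FP FQ] PQ] := Fc e e0.
  exists (P `&` Q) => [|u v [Pu _] [_ Qv]]; first exact: filterI.
  by have := PQ (u, v) (conj Pu Qv); rewrite /= -ball_normE => /ltW.
have cvg_comp (V : completeNormedModType R) (g : graph_space -> V) :
    (forall u v, `|g u - g v| <= `|u - v|) -> exists l : V, g u @[u --> F] --> l.
  move=> gle; suff /cvg_ex[l gl] : cvg (g @ F) by exists l.
  apply: cauchy_cvg; apply/cauchy_ballP => e e0.
  have [P FP Pe] := small (e / 2) (divr_gt0 e0 (ltr0Sn _ 1)).
  have FgP : F (g @^-1` (g @` P)) by apply: filterS FP => u Pu; exists u.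
  exists (g @` P, g @` P); first by split.
  move=> [_ _] /= [[u Pu <-] [v Pv <-]]; rewrite -ball_normE /=.
  apply: le_lt_trans (gle _ _) _; apply: le_lt_trans (Pe _ _ Pu Pv) _.
  by rewrite ltr_pdivrMr// mulr_natr mulr2n ltrDl.
have [y yF] := cvg_comp _ (fun u => u.2) (fun u v => graph_vec_le (u - v)).
have /choice[z zF] n : exists l : R^o, u.1 n @[u --> F] --> l.
  exact: (cvg_comp _ (fun u => u.1 n) (fun u v => graph_seq_le (u - v) n)).
have close e : 0 < e -> exists2 P, F P &
    forall u, P u -> (forall n, `|u.1 n - z n| <= e) /\ `|u.2 - y| <= e.
  move=> e0; have [P FP Pe] := small e e0; exists P => // u Pu; split=> [n|].
    apply: (@near_lim_dist_le R _ F R^o (fun v => v.1 n) _ _ P e FF (zF n) FP) => v Pv.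
    exact: le_trans (graph_seq_le (u - v) n) (Pe _ _ Pu Pv).
  apply: (@near_lim_dist_le R _ F Y (fun v => v.2) _ _ P e FF yF FP) => v Pv.
  exact: le_trans (graph_vec_le (u - v)) (Pe _ _ Pu Pv).
have zyP : (z, y) \in graph_pred.
  apply/asboolP; split.
    have [P FP Pe] := close 1 ltr01; have [u Pu] := filter_ex FP.
    have [uz _] := Pe u Pu; exists (`|u| + 1) => n /=.
    rewrite -[z n](subrK (u.1 n)) addrC (le_trans (ler_normD _ _))// lerD ?graph_seq_le//.
    by rewrite distrC.
  move=> phi b Ab [D bD]; apply/cvgrPdist_le => e e0 /=.
  have D0 : 0 <= D by have := bD 0; rewrite big_nil.
  pose d := e / 2 / (`|phi| + D + 1).
  have phiD : 0 < `|phi| + D + 1 by rewrite ltr_wpDl// addr_ge0.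
  have d0 : 0 < d by rewrite !divr_gt0.
  have [P FP Pe] := close d d0; have [u Pu] := filter_ex FP.
  have [uz uy] := Pe u Pu; have [_ /(_ phi b Ab)] := graphP u.
  have b1 : exists D, forall N, \sum_(0 <= n < N) `|b n| <= D by exists D.
  move=> /(_ b1)/cvgrPdist_le/(_ (e / 2)) [|N0 _ N0P]; first by rewrite divr_gt0.
  exists N0 => // N /N0P /= uN.
  have -> : phi y - [series b n * z n]_n N = (phi u.2 - [series b n * u.1 n]_n N) -
      phi (u.2 - y) + \sum_(0 <= n < N) b n * (u.1 n - z n).
    rewrite bopB (eq_bigr (fun n => b n * u.1 n - b n * z n)) => [|n _]; last by rewrite mulrBr.
    by rewrite sumrB /series /=; lra.
  rewrite (le_trans (ler_normD _ _))// (splitr e).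
  have phiuy : `|phi (u.2 - y)| <= `|phi| * d.
    by rewrite (le_trans (bop_le _ _))// ler_wpM2l.
  have sumuz : `|\sum_(0 <= n < N) b n * (u.1 n - z n)| <= D * d.
    rewrite (le_trans (ler_norm_sum _ _ _))//.
    apply: le_trans (ler_wpM2r (ltW d0) (bD N)); rewrite mulr_suml.
    by apply: ler_sum => n _; rewrite normrM ler_wpM2l.
  have dE : (`|phi| + D + 1) * d = e / 2 by rewrite mulrC divfK ?gt_eqF.
  have := ler_normB (phi u.2 - [series b n * u.1 n]_n N) (phi (u.2 - y)).
  lra.
apply/cvg_ex; exists (MkGraph zyP); apply/cvgrPdist_le => e e0.
have [P FP Pe] := close e e0; apply: filterS FP => u /Pe[uz uy].
apply: graph_norm_le => [n|]; first by rewrite -[X in `|X|]/(z n - u.1 n) distrC.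
by rewrite -[X in `|X|]/(y - u.2) distrC.
Qed.

HB.instance Definition _ := Uniform_isComplete.Build graph_space graph_complete.

Definition graph_proj u : Y := u.2.

Lemma graph_proj_bop : exists U : bop graph_space Y, U = graph_proj :> (_ -> _).
Proof.
have gl : linear graph_proj by [].
pose g : {linear graph_space -> Y} := HB.pack graph_proj (GRing.isLinear.Build _ _ _ _ _ gl).
have gle x : `|g x| <= 1 * `|x| by rewrite mul1r; exact: graph_vec_le.
exact: bounded_linear_bop gle.
Qed.

Lemma graph_seq_functional n :
  exists2 delta : dual_space graph_space, `|delta| <= 1 & forall u, delta u = u.1 n.
Proof.
pose h u : R^o := u.1 n; have hl : linear h by [].
pose g : {linear graph_space -> R^o} := HB.pack h (GRing.isLinear.Build _ _ _ _ _ hl).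
have gle x : `|g x| <= 1 * `|x| by rewrite mul1r; exact: graph_seq_le.
have [T TE] := bounded_linear_bop gle; exists T; last by move=> u; rewrite TE.
by apply: bop_norm_le => // x; rewrite TE.
Qed.

End graph_space.

(** * Factorization of maps with a p-compact transpose *)

Section factorization.
Context {R : realType} (X : normedModType R) (Y : completeNormedModType R).
Variables (p : R) (f : lip0 X Y).
Hypothesis p1 : 1 <= p.

Let p0 : 0 < p := ge1_gt0 p1.

(** The Abel-Dini trick: with the tails [r n] of [\sum c n ^ p], the weights
    [beta n = r n ^ (1 / 2p)] tend to 0 while
    [(c n / beta n) ^ p = (r n - r n.+1) / sqrt (r n)] telescopes, being at most
    [2 (sqrt (r n) - sqrt (r n.+1))]. *)
Lemma null_factorization (c : nat -> R) B : (forall n, 0 <= c n) ->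
  (forall N, \sum_(0 <= n < N) c n `^ p <= B) ->
  exists d beta : nat -> R, [/\ forall n, 0 <= d n, forall n, 0 <= beta n <= beta 0%N,
    forall n, c n = d n * beta n,
    exists D, forall N, \sum_(0 <= n < N) d n `^ p <= D & beta @ \oo --> 0].
Proof.
move=> c0 cB; pose s N := \sum_(0 <= n < N) c n `^ p.
have s_ub : has_ubound (range s) by exists B => _ [N _ <-]; exact: cB.
have s_nd : nondecreasing_seq s.
  apply/nondecreasing_seqP => N; rewrite /s big_nat_recr//= lerDl; exact: powR_ge0.
pose r n := sup (range s) - s n.
have r0 n : 0 <= r n by rewrite subr_ge0; apply: ub_le_sup => //; exists n.
have rS n : r n - r n.+1 = c n `^ p.
  by rewrite /r /s big_nat_recr//=; lra.
have r_cvg : r @ \oo --> 0.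
  rewrite -(subrr (sup (range s))); apply: cvgB; first exact: cvg_cst.
  exact: nondecreasing_cvgn.
(* If r n = 0 then c n = 0 as well, and the division by 0 gives d n = 0. *)
pose q n := Num.sqrt (r n).
pose beta n := q n `^ p^-1.
pose d n := c n / beta n.
have betap n : beta n `^ p = q n.
  by rewrite /beta -powRrM mulVf ?gt_eqF// powRr1// sqrtr_ge0.
have qq n : q n * q n = r n by rewrite -expr2 sqr_sqrtr.
have qS n : q n.+1 <= q n.
  by rewrite ler_sqrt// -subr_ge0 rS powR_ge0.
have q0 n : 0 <= q n by exact: sqrtr_ge0.
have beta0 n : (beta n == 0) = (q n == 0).
  by rewrite /beta powR_eq0 invr_eq0 (gt_eqF p0) andbT.
have c_eq0 n : q n = 0 -> c n = 0.
  move=> qn; have : c n `^ p <= 0.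
    by rewrite -rS -[r n]qq qn mul0r sub0r oppr_le0.
  move=> cp; have /eqP : c n `^ p = 0 by apply/eqP; rewrite eq_le cp powR_ge0.
  by rewrite powR_eq0 => /andP[/eqP].
have q_nonincr n : q n <= q 0%N by elim: n => // n; exact: le_trans.
exists d, beta; split=> [n|n|n||].
- by rewrite divr_ge0// powR_ge0.
- rewrite powR_ge0; apply: ge0_ler_powR (q_nonincr n); rewrite ?nnegrE//.
  by rewrite invr_ge0 ltW.
- have [b0|b0] := eqVneq (beta n) 0; last by rewrite divfK.
  by rewrite b0 mulr0; apply: c_eq0; apply/eqP; rewrite -beta0 b0.
- exists (2 * q 0%N) => N.
  apply: (@le_trans _ _ (\sum_(0 <= n < N) 2 * (q n - q n.+1))).
    apply: ler_sum => n _.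
    have [qn|qn] := eqVneq (q n) 0.
      rewrite /d c_eq0// mul0r powR0 ?gt_eqF// mulr_ge0// subr_ge0//.
    have qn0 : 0 < q n by rewrite lt0r qn q0.
    rewrite /d powRM ?invr_ge0 ?powR_ge0//.
    rewrite -[X in _ * X `^ p]powR_inv1 ?powR_ge0// powRAC betap powR_inv1//.
    rewrite ler_pdivrMr// -rS -!qq.
    have := qS n; have := q0 n.+1; nra.
  rewrite -mulr_sumr ler_pM2l//.
  rewrite (@telescope_sumr_eq _ _ _ (fun n => - q n))// => [|n _].
    by rewrite opprK addrC gerDl oppr_le0.
  by rewrite opprK addrC.
- apply/cvgrPdist_le => e e0.
  have ep0 : 0 < e `^ p by exact: powR_gt0.
  move/cvgrPdist_le : r_cvg => /(_ _ (mulr_gt0 ep0 ep0)); apply: filterS => n.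
  rewrite !sub0r !normrN (ger0_norm (r0 n)) ger0_norm ?powR_ge0// => rn.
  have qn : q n <= e `^ p by rewrite -[leRHS](ger0_norm (ltW ep0)) -sqrtr_sqr ler_sqrt ?sqr_ge0// expr2.
  rewrite -[leRHS]powRr1 ?(ltW e0)// -(mulfV (lt0r_neq0 p0)) powRrM.
  by apply: ge0_ler_powR qn; rewrite ?nnegrE ?invr_ge0 ?(ltW p0) ?(ltW ep0).
Qed.


Variables (e : nat -> lip_dual X) (d beta : nat -> R) (D : R).
Hypotheses (d0 : forall n, 0 <= d n) (betab : forall n, 0 <= beta n <= beta 0%N).
Hypothesis eE : forall n, `|e n| = d n * beta n.
Hypothesis dD : forall N, \sum_(0 <= n < N) d n `^ p <= D.
Hypothesis beta_cvg : beta @ \oo --> 0.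
Hypothesis expand : forall phi : dual_space Y, `|phi| <= 1 ->
  exists2 a, lp_ball (hoelder_conjugate p%:E) a &
    forall x, [series a n * e n x]_n @ \oo --> phi (f x).

(** The coefficients are multiplied by [d] because the sequences [(e n x)_n] are
    divided by it. *)
Definition expansions : set (dual_space Y * (nat -> R))%type := 
  [set u : (dual_space Y * (nat -> R))%type | exists a,
  [/\ `|u.1| <= 1, lp_ball (hoelder_conjugate p%:E) a, u.2 = (fun n => a n * d n) &
      forall x, [series a n * e n x]_n @ \oo --> (u.1 : dual_space Y) (f x)]].

Local Notation Z := (@graph_space R Y expansions).

Let D0 : 0 <= D. Proof. by have := dD 0; rewrite big_nil. Qed.

Lemma expansion_summable a : lp_ball (hoelder_conjugate p%:E) a ->
  exists D, forall N, \sum_(0 <= n < N) `|a n * d n| <= D.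
Proof.
move=> /(lp_ballP _ p1) aP; exists (D `^ p^-1) => N.
rewrite (eq_bigr (fun n => a n * (Num.sg (a n) * d n))) => [|n _]; last first.
  by rewrite normrM (ger0_norm (d0 n)) mulrA [a n * _]mulrC -normrEsg.
apply: le_trans (aP N _) _; apply: ge0_ler_powR; rewrite ?nnegrE ?invr_ge0 ?(ltW p0) ?powR_sum_ge0//.
apply: le_trans (dD N); apply: ler_sum => n _.
apply: ge0_ler_powR; rewrite ?nnegrE ?(ltW p0)//.
rewrite normrM (ger0_norm (d0 n)) ler_piMl// normr_sg.
by case: (_ == _).
Qed.

(** Hoelder's inequality for the expansion of a functional norming [u.2]. *)
Lemma graph_vec_approx (u : Z) (s : R) : 0 < s -> exists N0, forall N, (N0 <= N)%N ->
  `|u.2| <= (\sum_(0 <= n < N) `|d n * u.1 n| `^ p) `^ p^-1 + s.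
Proof.
move=> s0; have [phi [phi1 phiu]] := norming_functional u.2.
have [a a1 aexp] := expand phi1.
have Ea : expansions (phi, fun n => a n * d n) by exists a.
have [_ /(_ _ _ Ea (expansion_summable a1))] := graphP u.
move=> /cvgrPdist_le/(_ s s0)[N0 _ N0P]; exists N0 => N /N0P /=.
rewrite phiu => /(le_trans (ler_norm _)); rewrite lerBlDl => /le_trans; apply.
rewrite lerD2r /series /=.
rewrite (eq_bigr (fun n => a n * (d n * u.1 n))) => [|n _]; last by rewrite mulrA.
by move/(lp_ballP _ p1) : a1; apply.
Qed.

(** The projection factors through the diagonal operator with coefficients [d]:
    its p-th powers are bounded by those of [(d k * z k)_k], and the sum over the
    family is taken on truncations before passing to the limit. *)
Lemma graph_vec_sum_le (n : nat) (z : 'I_n -> Z) (K : R) :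
  (forall N, \sum_(i < n) \sum_(0 <= k < N) `|d k * (z i).1 k| `^ p <= K) ->
  \sum_(i < n) `|(z i).2| `^ p <= K.
Proof.
move=> zK; pose t i N := \sum_(0 <= k < N) `|d k * (z i).1 k| `^ p.
have t_ub i : has_ubound (range (t i)).
  exists K => _ [N _ <-]; apply: le_trans (zK N); rewrite (bigD1 i)//= lerDl.
  by apply: sumr_ge0 => j _; exact: powR_sum_ge0.
have t_nd i : nondecreasing_seq (t i).
  by apply/nondecreasing_seqP => N; rewrite /t big_nat_recr//= lerDl; exact: powR_ge0.
have t_cvg i := nondecreasing_cvgn (t_nd i) (t_ub i).
have t_le i N : t i N <= sup (range (t i)) by apply: ub_le_sup => //; exists N.
have t_ge i : `|(z i).2| `^ p <= sup (range (t i)).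
  have T0 : 0 <= sup (range (t i)) by apply: le_trans (t_le i 0%N); rewrite /t big_nil.
  rewrite -[leRHS]powRr1// -(mulVf (lt0r_neq0 p0)) powRrM.
  apply: ge0_ler_powR; rewrite ?nnegrE ?powR_ge0 ?(ltW p0)//.
  apply/ler_addgt0Pr => s s0; have [N0 /(_ N0 (leqnn _))] := graph_vec_approx (z i) s0.
  move=> /le_trans; apply; rewrite lerD2r.
  by apply: ge0_ler_powR (t_le i N0); rewrite ?nnegrE ?invr_ge0 ?(ltW p0) ?powR_sum_ge0.
apply: le_trans (ler_sum _ (fun i _ => t_ge i)) _.
have : (fun N => \sum_(i < n) t i N) @ \oo --> \sum_(i < n) sup (range (t i)).
  by apply: cvg_big => //; exact: add_continuous.
move=> tc; rewrite -(cvg_lim _ tc)//; apply: limr_le; first by apply/cvg_ex; eexists; exact: tc.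
by apply: nearW => N; exact: zK.
Qed.

Lemma graph_vec_le_sup (u : Z) (t : R) : 0 <= t -> (forall n, `|u.1 n| <= t) ->
  `|u.2| <= D `^ p^-1 * t.
Proof.
move=> t0 ut; have : \sum_(i < 1) `|u.2| `^ p <= (D `^ p^-1 * t) `^ p.
  apply: (@graph_vec_sum_le 1 (fun=> u)) => N; rewrite big_ord1.
  rewrite powRM ?powR_ge0// -powRrM mulVf ?gt_eqF// powRr1//.
  apply: le_trans (ler_wpM2r (powR_ge0 _ _) (dD N)); rewrite mulr_suml.
  apply: ler_sum => n _; rewrite normrM powRM// (ger0_norm (d0 n)) ler_wpM2l ?powR_ge0//.
  by apply: ge0_ler_powR; rewrite ?nnegrE ?(ltW p0).
rewrite big_ord1 => /(@ge0_ler_powR _ p^-1).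
rewrite invr_ge0 (ltW p0) !nnegrE !powR_ge0 => /(_ isT isT isT).
by rewrite -!powRrM mulfV ?gt_eqF// !powRr1// mulr_ge0 ?powR_ge0.
Qed.

(** A diagonal operator is p-summing because the coordinates are functionals of
    norm at most one and its coefficients are p-summable. *)
Lemma graph_proj_p_summing (U : bop Z Y) : U = @graph_proj R Y expansions :> (Z -> Y) ->
  p_summing p U.
Proof.
move=> UE; exists (D `^ p^-1); first exact: powR_ge0.
move=> n z; set s := sup _.
have s0 : 0 <= s by apply: sup_image_ge0 => phi _; exact: powR_ge0.
pose g (phi : dual_space Z) := (\sum_(i < n) `|phi (z i)| `^ p) `^ p^-1.
have g_ub (phi : dual_space Z) : `|phi| <= 1 -> g phi <= (\sum_(i < n) `|z i| `^ p) `^ p^-1.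
  move=> phi1; apply: ge0_ler_powR; rewrite ?nnegrE ?invr_ge0 ?(ltW p0) ?powR_sum_ge0//.
  apply: ler_sum => i _; apply: ge0_ler_powR; rewrite ?nnegrE ?(ltW p0)//.
  by rewrite (le_trans (bop_le _ _))// ler_piMl.
have sP (phi : dual_space Z) : `|phi| <= 1 -> \sum_(i < n) `|phi (z i)| `^ p <= s `^ p.
  move=> phi1; have : g phi <= s := sup_image_ub g_ub phi1.
  move=> /(ge0_ler_powR (ltW p0)); rewrite !nnegrE powR_ge0 s0 => /(_ isT isT).
  by rewrite -powRrM mulVf ?gt_eqF// powRr1// powR_sum_ge0.
have : \sum_(i < n) `|(z i).2| `^ p <= D * s `^ p.
  apply: graph_vec_sum_le => N; rewrite exchange_big/=.
  apply: le_trans (ler_wpM2r (powR_ge0 _ _) (dD N)); rewrite mulr_suml.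
  apply: ler_sum => k _.
  have [delta delta1 deltaE] := @graph_seq_functional R Y expansions k.
  apply: le_trans (ler_wpM2l (powR_ge0 _ _) (sP delta delta1)); rewrite mulr_sumr.
  by apply: ler_sum => i _; rewrite deltaE normrM powRM// (ger0_norm (d0 k)).
rewrite UE /graph_proj => /(@ge0_ler_powR _ p^-1).
rewrite invr_ge0 (ltW p0) !nnegrE powR_sum_ge0 mulr_ge0 ?powR_ge0// => /(_ isT isT isT).
by move=> /le_trans; apply; rewrite powRM ?powR_ge0// -powRrM mulfV ?gt_eqF// powRr1.
Qed.

Lemma graph_lift : exists S : lip0 X Z,
  f = @graph_proj R Y expansions \o S :> (X -> Y) /\
  forall x y n, `|(S x - S y).1 n| <= beta n * `|x - y|.
Proof.
pose w x n : R^o := e n x / d n.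
have wE x n : d n * w x n = e n x.
  have [dn0|dn0] := eqVneq (d n) 0; last by rewrite mulrC divfK.
  have /eqP := eE n; rewrite dn0 !mul0r normr_eq0 => /eqP ->.
  by rewrite -[RHS]/(0 : R).
have wle x y n : `|w x n - w y n| <= beta n * `|x - y|.
  have [bn0 _] := andP (betab n).
  rewrite /w -mulrBl normrM normfV (ger0_norm (d0 n)).
  have [->|dn0] := eqVneq (d n) 0; first by rewrite invr0 mulr0 mulr_ge0.
  rewrite ler_pdivrMr ?lt0r ?dn0 ?d0// mulrAC [beta n * _]mulrC -eE.
  exact: (lip0_le (e n)).
have w0 n : w 0 n = 0 by rewrite /w (lip0P (e n)).2 mul0r.
have wb x n : `|w x n| <= beta 0%N * `|x|.
  rewrite -[w x n]subr0 -(w0 n) (le_trans (wle _ _ _))// subr0 ler_wpM2r//.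
  by case/andP: (betab n).
have SP x : (w x, f x) \in @graph_pred R Y expansions.
  apply/asboolP; split; first by exists (beta 0%N * `|x|) => n; exact: wb.
  move=> phi b [a [_ _ /= -> aexp]] _.
  have -> : [series a n * d n * w x n]_n = [series a n * e n x]_n.
    by apply/funext => N; apply: eq_bigr => n _ /=; rewrite -mulrA wE.
  exact: aexp.
pose S x : Z := MkGraph (SP x).
have SB x y n : (S x - S y).1 n = w x n - w y n by [].
have Slip : S \in lip0_pred X Z.
  apply/asboolP; split.
    apply/lipschitzP; exists (beta 0%N + `|f|) => x y.
    apply: graph_norm_le => [n|].
      rewrite SB (le_trans (wle _ _ _))// ler_wpM2r//.
      by rewrite ler_wpDr//; case/andP: (betab n).
    rewrite -[X in `|X|]/(f x - f y) (le_trans (lip0_le _ _ _))// ler_wpM2r//.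
    by rewrite lerDr; case/andP: (betab 0%N).
  apply/val_inj => /=; rewrite -[RHS]/((0 : nat -> R^o), (0 : Y)) (lip0P f).2.
  by congr (_, _); apply/funext => n; rewrite w0.
by exists (MkLip0 Slip); split=> // x y n; rewrite [X in `|X|]SB; exact: wle.
Qed.

(** Along an ultrafilter each coordinate converges; the coordinates from some
    rank on are uniformly small, and the component in [Y] is controlled by the
    others. *)
Lemma null_box_compact : compact [set u : Z | forall n, `|u.1 n| <= beta n].
Proof.
rewrite compact_ultra => F FU FK.
have /choice[z zF] n : exists l : R, (u : Z).1 n @[u --> F] --> l.
  pose g (u : Z) : R := u.1 n.
  have FI : F (g @^-1` `[- beta n, beta n]).
    by apply: filterS FK => u uK; rewrite /preimage /= in_itv/= -ler_norml; exact: (uK n).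
  have := @segment_compact R (- beta n) (beta n); rewrite compact_ultra.
  by move=> /(_ _ (ultra_fmap g FU) FI)[l [_ ?]]; exists l.
have Fcvg : cvg F.
  apply: cauchy_cvg; apply/cauchy_ballP => s s0.
  pose t := s / (2 * (D `^ p^-1 + 1 + 1)).
  have Dp0 : 0 <= D `^ p^-1 by exact: powR_ge0.
  have t0 : 0 < t by rewrite divr_gt0// mulr_gt0// ltr_wpDl// addr_ge0.
  have [N0 _ N0P] : \forall n \near \oo, `|0 - beta n| <= t.
    by move/cvgrPdist_le : beta_cvg; apply.
  have Fz : \forall u \near F, forall i : 'I_N0, `|z i - (u : Z).1 i| <= t.
    by apply: filter_forall => i; have /cvgrPdist_le := zF i; apply.
  pose P := [set u : Z | forall n, `|u.1 n| <= beta n] `&`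
            [set u : Z | forall i : 'I_N0, `|z i - u.1 i| <= t].
  have FP : F P by exact: filterI.
  exists (P, P) => // -[u v] /= [[uK uz] [vK vz]].
  have uv n : `|(u - v).1 n| <= 2 * t.
    rewrite -[X in `|X|]/(u.1 n - v.1 n) mulr_natl mulr2n.
    have [nN|nN] := ltnP n N0.
      rewrite -(subrKA (z n)) (le_trans (ler_normD _ _))// lerD//.
        by rewrite distrC; exact: (uz (Ordinal nN)).
      exact: (vz (Ordinal nN)).
    have := N0P n nN; rewrite /= sub0r normrN => /(le_trans (ler_norm _)) bn.
    by rewrite (le_trans (ler_normB _ _))// lerD// (le_trans _ bn).
  have t20 : 0 <= 2 * t by rewrite mulr_ge0// ltW.
  have uv2 := graph_vec_le_sup t20 uv.
  rewrite -ball_normE /=; apply: (@le_lt_trans _ _ ((D `^ p^-1 + 1) * (2 * t))).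
    apply: graph_norm_le => [n|].
      by rewrite (le_trans (uv n))// ler_peMl// lerDr.
    by rewrite (le_trans uv2)// ler_wpM2r// lerDl.
  have sE : (D `^ p^-1 + 1 + 1) * (2 * t) = s.
    rewrite /t (mulrA _ 2) [_ * 2]mulrC [LHS]mulrC divfK// gt_eqF// mulr_gt0//.
    by rewrite ltr_wpDl// addr_ge0.
  rewrite -[ltRHS]sE.
  by rewrite ltr_pM2r ?ltrDl// mulr_gt0.
exists (lim F); split => //= n.
have limn : (u : Z).1 n @[u --> F] --> ((lim F : Z).1 n : R^o).
  apply/cvgrPdist_le => s s0; have /cvgrPdist_le/(_ s s0) := Fcvg.
  by apply: filterS => u; exact: le_trans (graph_seq_le (lim F - u) n).
rewrite -normrN -sub0r.
apply: (@near_lim_dist_le R Z F R^o (fun u => u.1 n) 0 _ _ (beta n) _ limn FK) => u uK.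
by rewrite sub0r normrN; exact: uK.
Qed.

Lemma graph_factorization : exists (Z : completeNormedModType R) (S : lip0 X Z) (U : bop Z Y),
  [/\ lip_compact S, p_summing p U & f = U \o S :> (X -> Y)].
Proof.
have [S [fS Sle]] := graph_lift; have [U UE] := @graph_proj_bop R Y expansions.
exists Z, S, U; split; [|exact: graph_proj_p_summing|by rewrite UE].
exists [set u : Z | forall n, `|u.1 n| <= beta n]; last first.
  by split; [|apply: compact_closed; first exact: norm_hausdorff]; exact: null_box_compact.
move=> _ [[x y] /= xy <-] n.
rewrite -[X in `|X|]/(`|x - y|^-1 * (S x - S y).1 n) normrM normfV normr_id.
by rewrite ler_pdivrMl ?normr_gt0 ?subr_eq0// mulrC.
Qed.

End factorization.

Theorem p_compact_factorization (R : realType) (X : normedModType R)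
    (Y : completeNormedModType R) (p : R) (f : lip0 X Y) : 1 <= p ->
  lip_dual_p_compact p f ->
  exists (Z : completeNormedModType R) (S : lip0 X Z) (U : bop Z Y),
    [/\ lip_compact S, p_summing p U & f = U \o S :> (X -> Y)].
Proof.
move=> p1 /(_ [set phi | `|phi| <= 1])[|e [eoo esub]].
  by exists 1; split=> // M M1 phi /= /le_trans; apply; exact: ltW.
have [B eB] := (nneseries_ltyP (fun n => powR_ge0 `|e n| p)).1 eoo.
have [d [beta [d0 betab eE [D dD] beta_cvg]]] :=
  null_factorization p1 (fun n => normr_ge0 (e n)) eB.
apply: (graph_factorization p1 d0 betab eE dD beta_cvg) => phi phi1.
have [|a a1 acvg] := esub (lip_transpose f phi); first by exists phi.
exists a => // x; apply/cvgrPdist_le => s s0.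
have x0 : 0 < `|x| + 1 by rewrite ltr_wpDl.
have /cvgrPdist_le/(_ (s / (`|x| + 1)) (divr_gt0 s0 x0)) := acvg.
apply: filterS => N aN.
have -> : phi (f x) - [series a n * e n x]_n N =
    (lip_transpose f phi - [series a n *: e n]_n N) x.
  by rewrite -[RHS]/(phi (f x) - (\sum_(0 <= k < N) a k *: e k) x) lip0_sumE.
rewrite (le_trans (lip0_le0 _ _))// (le_trans (ler_wpM2r _ aN))//.
by rewrite mulrAC ler_pdivrMr// ler_wpM2l ?(ltW s0)// lerDl.
Qed.

Theorem proposition4p9 (R : realType) (X : normedModType R)
    (Y : completeNormedModType R) (p : R) (p1 : 1 <= p) (f : lip0 X Y) :
  lip_dual_p_compact p f <->
  exists (Z : completeNormedModType R) (S : lip0 X Z) (U : bop Z Y),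
    [/\ lip_compact S, p_summing p U & f = U \o S :> (X -> Y)].
Proof.
split=> [|[Z [S [U [Sc Us fE]]]]]; first exact: p_compact_factorization.
have [G [[B GB] UG]] := quasi_nuclear p1 Sc Us.
exact: (lip_dual_p_compact_of_quasi_nuclear p1 fE GB UG).
Qed.
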